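(* Let $u_h\in V_h$ be the solution of $a(u_h,v)=\ell(v)$ for all $v\in V_h$, let $v^0\in V_h$ be arbitrary, and let the sequence $\{v^j\}_{j\in\mathbb{N}}\subset V_h$ be generated by the MS-GFEM iteration $v^{j+1}=v^j+G(u_h-v^j)$, $j=0,1,\dots$, where $G$ is the MS-GFEM map. Let $\Lambda=\big(\xi\,\xi^{*}\max_{i=1,\dots,M}\lambda_{i,m_i+1}\big)^{1/2}$. Then $$\|v^{j+1}-u_h\|_a\le\Lambda\,\|v^j-u_h\|_a,\qquad j=0,1,\dots.$$
   Context: Setting. $\Omega\subset\mathbb{R}^d$, $d\in\{2,3\}$, is a bounded Lipschitz domain with polygonal boundary; $A\in (L^\infty(\Omega))^{d\times d}$ is pointwise symmetric with $\alpha|\zeta|^2\le A(x)\zeta\cdot\zeta\le\beta|\zeta|^2$ for all $\zeta\in\mathbb{R}^d$, $x\in\Omega$, with constants $0<\alpha<\beta<\infty$; $\ell$ is a linear functional on $H^1_0(\Omega)$. For a subdomain $\omega\subset\Omega$ set $a_\omega(u,v)=\int_\omega (A\nabla u)\cdot\nabla v\,dx$ and $\|u\|_{a,\omega}=\sqrt{a_\omega(u,u)}$; write $a=a_\Omega$, $\|\cdot\|_a=\|\cdot\|_{a,\Omega}$. $V_h\subset H^1_0(\Omega)$ is a finite element space of continuous piecewise polynomials on a shape-regular triangulation $\tau_h$ (mesh size $h$) of $\Omega$ into triangles/tetrahedra. For a subdomain $\omega$ resolved by $\tau_h$ (a union of mesh elements): $V_h(\omega)=\{v|_\omega: v\in V_h\}$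 and $V_{h,0}(\omega)=\{v|_\omega: v\in V_h,\ \operatorname{supp}(v)\subset\overline{\omega}\}$; elements of $V_{h,0}(\omega)$ are identified with their zero extensions. Decomposition. $\{\omega_i\}_{i=1}^M$ is an overlapping decomposition of $\Omega=\cup_i\omega_i$ into subdomains resolved by $\tau_h$; $\omega_i^*\supset\omega_i$ are oversampling subdomains of $\Omega$, also resolved by $\tau_h$. $\xi=\max_{x\in\Omega}\operatorname{card}\{i: x\in\omega_i\}$ and $\xi^*=\max_{x\in\Omega}\operatorname{card}\{i: x\in\omega_i^*\}$. $\{\chi_i\}$ is a partition of unity: $\operatorname{supp}(\chi_i)\subset\overline{\omega_i}$, $0\le\chi_i\le1$, $\sum_i\chi_i=1$ on $\Omega$, $\chi_i\in W^{1,\infty}(\omega_i)$, $\|\nabla\chi_i\|_{L^\infty(\omega_i)}\le C_\chi/\operatorname{diam}(\omega_i)$ (the $\chi_i$ are continuous and vanish outside $\omega_i$). The operators $\chi_{h,i}:V_h(\omega_i)\to V_{h,0}(\omega_i)$ are $\chi_{h,i}(v)=I_h(\chi_i v)$, with $I_h$ the Lagrange (nodal) interpolation into $V_h$; they satisfy $\sum_i\chi_{h,i}(v|_{\omega_i})=v$ for $v\in V_h$. Define $\widetilde\chi_{h,i}:V_{h,0}(\omega_i^* )\to V_{h,0}(\omega_i^* )$ by $\widetilde\chi_{h,i}(v)=\chi_{h,i}(v|_{\omega_i})$. Local spaces. $V_{h,A}(\omega_i^* )=\{v\in V_h(\omega_i^* ): a_{\omega_i^*}(v,w)=0\ \forall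 w\in V_{h,0}(\omega_i^* )\}$. Consider the eigenproblem: find $\lambda_i\in\mathbb{R}\cup\{+\infty\}$, $\phi_i\in V_{h,A}(\omega_i^* )$ with $$a_{\omega_i}(\chi_{h,i}(\phi_i|_{\omega_i}),\chi_{h,i}(v|_{\omega_i}))=\lambda_i\,a_{\omega_i^*}(\phi_i,v)\quad\forall v\in V_{h,A}(\omega_i^* ).$$ Eigenvalues $\lambda_{i,1}\ge\lambda_{i,2}\ge\cdots$ are in decreasing order (with multiplicity) with eigenfunctions $\phi_{i,1},\phi_{i,2},\dots$ forming a basis of $V_{h,A}(\omega_i^* )$ (with $a_{\omega_i^*}$-orthogonal finite-eigenvalue part); elements of the kernel of $a_{\omega_i^*}$ on $V_{h,A}(\omega_i^* )$ have eigenvalue $+\infty$; $\lambda_{i,m_i+1}:=0$ if $m_i=\dim V_{h,A}(\omega_i^* )$. For chosen integers $m_i$, $S_{m_i}(\omega_i)=\operatorname{span}\{\phi_{i,1}|_{\omega_i},\dots,\phi_{i,m_i}|_{\omega_i}\}$, and the coarse space is $S_m(\Omega)=\{\sum_{i=1}^M\chi_{h,i}(\phi_i):\phi_i\in S_{m_i}(\omega_i)\}\subset V_h$. If $\Lambda=+\infty$ the estimate is vacuous. MS-GFEM map. $\pi_i$ and $\pi_S$ are the $a$-orthogonal projections of $V_h$ onto $V_{h,0}(\omega_i^* )$ and $S_m(\Omega)$, and $G:V_h\to V_h$ is $$G(v)=\sum_{i=1}^M\widetilde\chi_{h,i}\pi_i(v)+\pi_S\Big(v-\sum_{i=1}^M\widetilde\chi_{h,i}\pi_i(v)\Big).$$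 *)

(* Defs.v *)
From HB Require Import structures.
From mathcomp Require Import all_boot all_order all_algebra.
From mathcomp Require Import all_classical all_reals all_analysis.

Set Implicit Arguments.
Unset Strict Implicit.
Unset Printing Implicit Defensive.

Import Order.TTheory GRing.Theory Num.Theory.
Import numFieldNormedType.Exports.

Local Open Scope classical_set_scope.
Local Open Scope ring_scope.

(* Row vectors carry the product sigma-algebra, which is the Borel one. *)
Definition rV_display : measure_display.
Proof. exact: default_measure_display. Qed.

Section measurable_rV.
Context {R : realType} {d : nat}.

Definition rV_coord (j : 'I_d) (x : 'rV[R]_d) : R := x ord0 j.

Let sigma0 : g_sigma_preimage rV_coord set0.
Proof. exact: sigma_algebra0. Qed.

Let sigmaC B : g_sigma_preimage rV_coord B -> g_sigma_preimage rV_coord (~` B).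
Proof. exact: sigma_algebraC. Qed.

Let sigmaU (F : (set 'rV[R]_d)^nat) :
  (forall i, g_sigma_preimage rV_coord (F i)) ->
  g_sigma_preimage rV_coord (\bigcup_i F i).
Proof. exact: sigma_algebra_bigcup. Qed.

HB.instance Definition _ := @isMeasurable.Build rV_display 'rV[R]_d
  (g_sigma_preimage rV_coord) sigma0 sigmaC sigmaU.

Lemma measurable_rV_coord (j : 'I_d) : measurable_fun [set: 'rV[R]_d] (rV_coord j).
Proof.
move=> _ Y mY; rewrite setTI; apply: sub_sigma_algebra => /=.
rewrite -bigcup_seq/=; exists j => /=; first by rewrite mem_index_enum.
by exists Y => //; rewrite setTI.
Qed.

Lemma measurable_fun_rV d1 (T1 : measurableType d1) (f : T1 -> 'rV[R]_d) :
  (forall j, measurable_fun [set: T1] (rV_coord j \o f)) ->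
  measurable_fun [set: T1] f.
Proof.
move=> mf; apply: (@measurability _ _ _ _ _ _
    (\big[setU/set0]_(i < d) preimage_set_system setT (rV_coord i) measurable)) => //.
move=> _ [B + <-]; rewrite -bigcup_seq/= => -[j _ [C mC <-]].
rewrite !setTI -[X in measurable X]setTI -comp_preimage; exact: mf.
Qed.

End measurable_rV.

Section lebesgue_rV.
Context {R : realType}.

Definition rV_cons n (p : R * 'rV[R]_n) : 'rV[R]_n.+1 :=
  \row_j (if unlift ord0 j is Some i then p.2 ord0 i else p.1).

Definition rV_uncons n (x : 'rV[R]_n.+1) : R * 'rV[R]_n :=
  (x ord0 ord0, \row_j x ord0 (lift ord0 j)).

Lemma rV_cons0 n (p : R * 'rV[R]_n) : rV_cons p ord0 ord0 = p.1.
Proof. by rewrite mxE unlift_none. Qed.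

Lemma rV_cons_lift n (p : R * 'rV[R]_n) (j : 'I_n) :
  rV_cons p ord0 (lift ord0 j) = p.2 ord0 j.
Proof. by rewrite mxE liftK. Qed.

Lemma rV_consK n : cancel (@rV_cons n) (@rV_uncons n).
Proof.
move=> [t x]; rewrite /rV_uncons rV_cons0; congr pair.
by apply/rowP => j; rewrite mxE rV_cons_lift.
Qed.

Lemma measurable_rV_cons n : measurable_fun setT (@rV_cons n).
Proof.
apply: measurable_fun_rV => j; case: (unliftP ord0 j) => [i|] ->.
  rewrite (_ : _ \o _ = rV_coord i \o snd); last first.
    by apply/funext => p; rewrite /= /rV_coord rV_cons_lift.
  exact: measurableT_comp (measurable_rV_coord i) measurable_snd.
rewrite (_ : _ \o _ = fst); first exact: measurable_fst.
by apply/funext => p; rewrite /= /rV_coord rV_cons0.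
Qed.

Lemma measurable_rV_uncons n : measurable_fun setT (@rV_uncons n).
Proof.
apply: measurable_fun_pair; first exact: measurable_rV_coord.
apply: measurable_fun_rV => j.
rewrite (_ : _ \o _ = rV_coord (lift ord0 j)); first exact: measurable_rV_coord.
by apply/funext => x; rewrite /= /rV_coord mxE.
Qed.

Section step.
Context n (mu : {sigma_finite_measure set 'rV[R]_n -> \bar R}).

Definition lebesgue_rV_step : set 'rV[R]_n.+1 -> \bar R :=
  pushforward (@lebesgue_measure R \x mu)%E (@rV_cons n).

Let m0 : lebesgue_rV_step set0 = 0%E.
Proof. by rewrite /lebesgue_rV_step /pushforward preimage_set0 measure0. Qed.

Let m_ge0 A : (0 <= lebesgue_rV_step A)%E.
Proof. exact: (measure_ge0 (@lebesgue_measure R \x mu)%E). Qed.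

Let mU : semi_sigma_additive lebesgue_rV_step.
Proof.
move=> F mF tF mUF; rewrite /lebesgue_rV_step /pushforward preimage_bigcup.
have mE A : measurable A -> measurable (@rV_cons n @^-1` A).
  by move=> mA; rewrite -[X in measurable X]setTI; exact: measurable_rV_cons.
apply: (@measure_semi_sigma_additive _ _ _ (@lebesgue_measure R \x mu)%E).
- by move=> k; exact: mE.
- apply/trivIsetP => /= i j _ _ ij; rewrite -preimage_setI.
  by move/trivIsetP : tF => /(_ _ _ _ _ ij) ->//; rewrite preimage_set0.
- by rewrite -preimage_bigcup; exact: mE.
Qed.

HB.instance Definition _ := isMeasure.Build _ _ _ lebesgue_rV_step m0 m_ge0 mU.

Let sf : sigma_finite setT lebesgue_rV_step.
Proof.
have /sigma_finiteP[F [TF ndF Foo]] := sigma_finiteT (@lebesgue_measure R).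
have /sigma_finiteP[G [TG ndG Goo]] := sigma_finiteT mu.
exists (fun k => @rV_uncons n @^-1` (F k `*` G k)).
  rewrite -preimage_bigcup -[LHS](preimage_setT (@rV_uncons n)) -setXTT TF TG.
  congr (_ @^-1` _); apply/seteqP; split=> [[x y] [/= [k _ Fx] [l _ Gy]]|].
    exists (maxn k l) => //; split.
    - by move: x Fx; exact/subsetPset/ndF/leq_maxl.
    - by move: y Gy; exact/subsetPset/ndG/leq_maxr.
  by move=> [x y] [k _ []/= ? ?]; split; exists k.
move=> k; have [mF Fk] := Foo k; have [mG Gk] := Goo k; split.
  rewrite -[X in measurable X]setTI.
  by apply: measurable_rV_uncons => //; exact: measurableX.
rewrite /lebesgue_rV_step /pushforward -comp_preimage.
rewrite (_ : _ \o _ = id); last by apply/funext => p; exact: rV_consK.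
by rewrite preimage_id product_measure1E// lte_mul_pinfty// ge0_fin_numE.
Qed.

HB.instance Definition _ := Measure_isSigmaFinite.Build _ _ _ lebesgue_rV_step sf.

End step.

Definition lebesgue_rVS n (mu : {sigma_finite_measure set 'rV[R]_n -> \bar R}) :
  {sigma_finite_measure set 'rV[R]_n.+1 -> \bar R} := lebesgue_rV_step mu.

Definition lebesgue_rV0 : {sigma_finite_measure set 'rV[R]_0 -> \bar R} :=
  \d_(0 : 'rV[R]_0).

Fixpoint lebesgue_rV n : {sigma_finite_measure set 'rV[R]_n -> \bar R} :=
  if n is n'.+1 then lebesgue_rVS (lebesgue_rV n') else lebesgue_rV0.

Lemma lebesgue_rV_box n (B : 'I_n -> set R) :
  (forall j, measurable (B j)) ->
  lebesgue_rV n [set x | forall j, B j (x ord0 j)] =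
  (\prod_(j < n) lebesgue_measure (B j))%E.
Proof.
elim: n B => [|n IH] B mB.
  rewrite big_ord0 /= diracE mem_set//; by move=> [].
have mBS : measurable [set x : 'rV[R]_n | forall j, B (lift ord0 j) (x ord0 j)].
  rewrite [X in measurable X](_ : _ = \bigcap_(j in setT)
      (@rV_coord R n j @^-1` B (lift ord0 j))).
    apply: fin_bigcap_measurable => // j _.
    by rewrite -[X in measurable X]setTI; exact: measurable_rV_coord.
  by apply/seteqP; split=> x /= Bx j; [move=> _; exact: Bx|exact: Bx].
rewrite big_ord_recl -(IH (fun j => B (lift ord0 j)))//.
rewrite -(@product_measure1E _ _ _ _ _ (@lebesgue_measure R) (lebesgue_rV n))//; last exact: mB.
congr (product_measure1 _ _ _); apply/seteqP; split=> [[t x] Btx|[t x] [/= Bt Bx]].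
  split=> /= [|j]; first by have := Btx ord0; rewrite rV_cons0.
  by have := Btx (lift ord0 j); rewrite rV_cons_lift.
move=> j; case: (unliftP ord0 j) => [i|] ->.
  by rewrite rV_cons_lift; exact: Bx.
by rewrite rV_cons0.
Qed.

End lebesgue_rV.

Section euclidean.
Context {R : realType} {d : nat}.
Local Notation point := 'rV[R]_d.

(* The library norm of 'rV_d is the sup norm. *)
Definition dotv (x y : point) : R := \sum_(j < d) x ord0 j * y ord0 j.
Definition enorm (x : point) : R := Num.sqrt (dotv x x).
Definition ediam (S : set point) : R := sup [set enorm (x - y) | x in S & y in S].

Definition partial (j : 'I_d) (f : point -> R) : point -> R :=
  fun x => 'D_(delta_mx ord0 j) f x.
Definition grad (f : point -> R) (x : point) : point := \row_j partial j f x.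

Definition smooth (f : point -> R) :=
  forall (s : seq 'I_d) (x : point), differentiable (foldr partial f s) x.

(* C_c^oo(omega) *)
Definition test_function (omega : set point) (f : point -> R) :=
  [/\ smooth f, compact (closure [set x | f x != 0])
    & closure [set x | f x != 0] `<=` omega].

Definition weak_gradient (omega : set point) (f : point -> R)
    (g : point -> point) :=
  forall psi, test_function omega psi -> forall j : 'I_d,
    (\int[lebesgue_rV d]_(x in omega) (f x * partial j psi x) =
     - \int[lebesgue_rV d]_(x in omega) (g x ord0 j * psi x))%R.

(* f lies in W^{1,oo}(omega) and |grad f| <= C almost everywhere *)
Definition W1infty_grad_le (omega : set point) (f : point -> R) (C : R) :=
  [/\ measurable_fun omega f,
      exists B : R, {ae lebesgue_rV d, forall x, omega x -> `|f x| <= B}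
    & exists g : point -> point,
      [/\ forall j, measurable_fun omega (fun x => g x ord0 j),
          weak_gradient omega f g
        & {ae lebesgue_rV d, forall x, omega x -> enorm (g x) <= C}]].

(* H^1_0(Omega) as the closure of C_c^oo(Omega) in H^1(Omega) *)
Definition H10 (Omega : set point) : set (point -> R) :=
  [set u : point -> R | measurable_fun Omega u /\
    exists (g : point -> point) (psi : nat -> point -> R),
    [/\ forall j, measurable_fun Omega (fun x => g x ord0 j),
        forall n, test_function Omega (psi n),
        (\int[lebesgue_rV d]_(x in Omega) ((u x - psi n x) ^+ 2)%:E)%E
          @[n --> \oo] --> 0%E
      & (\int[lebesgue_rV d]_(x in Omega) (enorm (g x - grad (psi n) x) ^+ 2)%:E)%E
          @[n --> \oo] --> 0%E]].

(* Elements of H^1_0 are represented by functions, so l must not see null sets. *)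
Definition linear_functional_H10 (Omega : set point) (l : (point -> R) -> R) :=
  (forall (c : R) (u v : point -> R), H10 Omega u -> H10 Omega v ->
     l (c *: u + v) = c * l u + l v) /\
  (forall u v : point -> R, H10 Omega u -> H10 Omega v ->
     {ae lebesgue_rV d, forall x, Omega x -> u x = v x} -> l u = l v).

(* Near each boundary point, Omega is the region above the graph of a Lipschitz
   function over the hyperplane orthogonal to the unit vector e; gamma is
   extended to the whole space as a function constant along e. *)
Definition lipschitz_boundary (Omega : set point) :=
  forall p, (closure Omega `\` Omega) p ->
  exists (e : point) (gamma : point -> R) (r L : R),
    [/\ enorm e = 1, 0 < r,
        forall x y, `|gamma x - gamma y| <= L * enorm (x - y),
        forall x (t : R), gamma (x + t *: e) = gamma x
      & forall x, ball p r x -> (Omega x <-> gamma x < dotv x e)].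

Definition polygonal_boundary (Omega : set point) :=
  exists H : seq (point * R), (forall q, q \in H -> q.1 != 0) /\
    forall x, (closure Omega `\` Omega) x -> exists2 q, q \in H & dotv q.1 x = q.2.

Record polygonal_lipschitz_domain (Omega : set point) : Prop := {
  domain_open : open Omega ;
  domain_connected : connected Omega ;
  domain_nonempty : Omega !=set0 ;
  domain_bounded : bounded_set Omega ;
  domain_lipschitz : lipschitz_boundary Omega ;
  domain_polygonal : polygonal_boundary Omega }.

(* Points are rows, so A acts on them as *m A^T. *)
Record elliptic_coefficient (Omega : set point) (A : point -> 'M[R]_d)
    (alpha beta : R) : Prop := {
  coef_measurable : forall i j, measurable_fun Omega (fun x => A x i j) ;
  coef_bounded : exists B : R, forall i j,
    {ae lebesgue_rV d, forall x, Omega x -> `|A x i j| <= B} ;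
  coef_sym : forall x, Omega x -> (A x)^T = A x ;
  coef_consts : 0 < alpha < beta ;
  coef_elliptic : forall x zeta, Omega x ->
    alpha * enorm zeta ^+ 2 <= dotv (zeta *m (A x)^T) zeta <= beta * enorm zeta ^+ 2 }.

(* Convex hull of the vertices p i with P i *)
Definition face (p : 'I_d.+1 -> point) (P : 'I_d.+1 -> Prop) : set point :=
  [set x | exists t : 'I_d.+1 -> R,
    [/\ forall i, 0 <= t i, forall i, ~ P i -> t i = 0, \sum_i t i = 1
      & x = \sum_i t i *: p i]].
Definition simplex (p : 'I_d.+1 -> point) := face p (fun=> True).

Record triangulation (Omega : set point) (I : finType)
    (T : I -> 'I_d.+1 -> point) : Prop := {
  mesh_nondegenerate : forall K,
    (\matrix_(i < d) (T K (lift ord0 i) - T K ord0)) \in unitmx ;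
  mesh_distinct : forall K K', range (T K) = range (T K') -> K = K' ;
  mesh_cover : closure Omega = \bigcup_K simplex (T K) ;
  mesh_conforming : forall K K',
    simplex (T K) `&` simplex (T K') = face (T K) (fun i => range (T K') (T K i)) }.

Definition mesh_size (I : finType) (T : I -> 'I_d.+1 -> point) : R :=
  \big[Num.max/0]_K ediam (simplex (T K)).

Definition shape_regular (I : finType) (T : I -> 'I_d.+1 -> point) (sigma : R) :=
  forall K, exists (c : point) (rho : R),
    [/\ 0 < rho, [set x | enorm (x - c) <= rho] `<=` simplex (T K)
      & ediam (simplex (T K)) <= sigma * rho].

Definition resolved (I : finType) (T : I -> 'I_d.+1 -> point) (omega : set point) :=
  exists J : {set I}, omega = (\bigcup_(K in [set` J]) simplex (T K))°.

Definition polynomial_on (k : nat) (S : set point) (f : point -> R) :=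
  exists c : {ffun 'I_d -> 'I_k.+1} -> R, forall x, S x ->
    f x = \sum_(a : {ffun 'I_d -> 'I_k.+1} | (\sum_j a j <= k)%N)
            c a * \prod_j x ord0 j ^+ a j.

End euclidean.

Section fem.
Context {R : realType} {d : nat} {I : finType}.
Local Notation point := 'rV[R]_d.
Local Notation fct := ('rV[R]_d -> R).
Variables (Omega : set point) (T : I -> 'I_d.+1 -> point) (k : nat).

(* Functions of V_h are extended by zero outside Omega. *)
Definition Vh : set fct :=
  [set v | [/\ continuous v, forall x, ~ Omega x -> v x = 0
    & forall K, polynomial_on k (simplex (T K)) v]].

(* v|_omega, represented by its extension by zero *)
Definition restr (omega : set point) (v : fct) : fct := patch (fun=> 0) omega v.

Definition Vh_on (omega : set point) : set fct := [set restr omega v | v in Vh].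

(* v itself is the zero extension of v|_omega *)
Definition Vh0 (omega : set point) : set fct :=
  [set v | Vh v /\ closure [set x | v x != 0] `<=` closure omega].

Definition lagrange_node (x : point) :=
  exists K (a : 'I_d.+1 -> nat),
    (\sum_i a i)%N = k /\ x = \sum_i ((a i)%:R / k%:R) *: T K i.

(* Nodes on the boundary carry no degree of freedom, as V_h vanishes there. *)
Definition lagrange_interpolation (Ih : fct -> fct) :=
  forall f, Vh (Ih f) /\ forall x, lagrange_node x -> Omega x -> Ih f x = f x.

(* Piecewise gradient: it represents the weak gradient of v in V_h, the mesh
   skeleton being a null set. *)
Definition mesh_grad (v : fct) (x : point) : point :=
  patch (fun=> 0) (\bigcup_K (simplex (T K))°) (grad v) x.

Variable A : point -> 'M[R]_d.

Definition energy (omega : set point) (u v : fct) : R :=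
  \int[lebesgue_rV d]_(x in omega)
    dotv (mesh_grad u x *m (A x)^T) (mesh_grad v x).

Definition energy_norm (omega : set point) (u : fct) : R :=
  Num.sqrt (energy omega u u).

Definition VhA (omega : set point) : set fct :=
  [set v | Vh_on omega v /\ forall w, Vh0 omega w -> energy omega v w = 0].

Definition energy_projection (W : set fct) (P : fct -> fct) :=
  forall v, Vh v -> W (P v) /\ forall w, W w -> energy Omega (v - P v) w = 0.

End fem.

Section decomposition.
Context {R : realType} {d M : nat} {I : finType}.
Local Notation point := 'rV[R]_d.
Local Notation fct := ('rV[R]_d -> R).
Implicit Types (Omega : set point) (w : 'I_M -> set point) (chi : 'I_M -> fct).

(* max over x in Omega of card {i | x in w i} *)
Definition overlap Omega w : nat :=
  \max_(J : {set 'I_M} |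
    `[< exists2 x, Omega x & J = [set i | x \in w i]%SET >]) #|J|.

Record partition_of_unity Omega w chi (Cchi : R) : Prop := {
  pou_continuous : forall i, {within Omega, continuous (chi i)} ;
  pou_vanish : forall i x, Omega x -> ~ w i x -> chi i x = 0 ;
  pou_supp : forall i,
    closure [set x | Omega x /\ chi i x != 0] `<=` closure (w i) ;
  pou_range : forall i x, Omega x -> 0 <= chi i x <= 1 ;
  pou_sum : forall x, Omega x -> \sum_i chi i x = 1 ;
  pou_gradient : forall i, W1infty_grad_le (w i) (chi i) (Cchi / ediam (w i)) }.

Definition chi_h (Ih : fct -> fct) chi (i : 'I_M) (v : fct) : fct :=
  Ih (chi i \* v).

Definition chi_h_tilde (Ih : fct -> fct) chi w (i : 'I_M) (v : fct) : fct :=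
  chi_h Ih chi i (restr (w i) v).

(* Eigenpairs are numbered from 0; eigenvalue +oo marks the kernel of a on W. *)
Record eigenbasis (W : set fct) (b a : fct -> fct -> R) (n : nat)
    (lam : nat -> \bar R) (phi : nat -> fct) : Prop := {
  eig_span : W = [set \sum_(l < n) c l *: phi l | c in [set: 'I_n -> R]] ;
  eig_free : forall c : 'I_n -> R,
    \sum_(l < n) c l *: phi l = 0 -> forall l, c l = 0 ;
  eig_range : forall l, (l < n)%N -> lam l != -oo%E ;
  eig_decreasing : forall l l', (l <= l' < n)%N -> (lam l' <= lam l)%E ;
  eig_kernel : forall l, (l < n)%N ->
    lam l = +oo%E <-> (forall v, W v -> a (phi l) v = 0) ;
  eig_eq : forall l (r : R), (l < n)%N -> lam l = r%:E ->
    forall v, W v -> b (phi l) v = r * a (phi l) v ;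
  eig_orthogonal : forall l l', (l < n)%N -> (l' < n)%N -> l != l' ->
    (lam l < +oo)%E -> (lam l' < +oo)%E -> a (phi l) (phi l') = 0 }.

(* lambda_{m+1} when eigenvalues are counted from 1 *)
Definition next_eigenvalue (n m : nat) (lam : nat -> \bar R) : \bar R :=
  if (m < n)%N then lam m else 0%E.

Definition local_space w (m : 'I_M -> nat) (phi : 'I_M -> nat -> fct)
    (i : 'I_M) : set fct :=
  [set \sum_(l < m i) c l *: restr (w i) (phi i l) | c in [set: 'I_(m i) -> R]].

Definition coarse_space (Ih : fct -> fct) chi w m phi : set fct :=
  [set \sum_i chi_h Ih chi i (s i) | s in
    [set s : 'I_M -> fct | forall i, local_space w m phi i (s i)]].

Definition msgfem_map (Ih : fct -> fct) chi w (P : 'I_M -> fct -> fct)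
    (PS : fct -> fct) (v : fct) : fct :=
  let p := \sum_i chi_h_tilde Ih chi w i (P i v) in p + PS (v - p).

End decomposition.

(* Main.v *)
Require Import Defs.
From HB Require Import structures.
From mathcomp Require Import all_boot all_order all_algebra.
From mathcomp Require Import all_classical all_reals all_analysis measurable_realfun.
From mathcomp Require Import ring lra.

Set Implicit Arguments.
Unset Strict Implicit.
Unset Printing Implicit Defensive.

Import Order.TTheory GRing.Theory Num.Theory.
Import numFieldNormedType.Exports.

Local Open Scope classical_set_scope.
Local Open Scope ring_scope.

(* Write e = u_h - v^j and p = sum_i chi_{h,i} (pi_i e), so that the new error is
   (I - pi_S)(e - p), whose energy is at most that of e - p - s for every s in
   the coarse space.  As the chi_{h,i} sum to the identity on V_h, e - p is the
   sum of the chi_{h,i} (e - pi_i e); each e - pi_i e is a-harmonic on the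
   oversampling domain, and taking for s the part of its expansion along the
   first m_i eigenfunctions leaves a tail whose image z_i satisfies
   |z_i|_{omega_i}^2 <= lambda_{i,m_i+1} |e|_{omega_i^*}^2.  At each point at
   most xi of the gradients of the z_i are nonzero, and at most xi^* of the
   omega_i^* contain it, which gives the two overlap factors.

   All of this rests on the unisolvence of the Lagrange nodes, which makes I_h
   linear, the identity on V_h, and local: on a mesh element outside omega_i the
   function chi_{h,i} v vanishes at all nodes, hence identically. *)

(** * Polynomial functions and unisolvence of lattice points *)

Section polynomial_functions.
Context {R : realType} {d : nat}.
Local Notation point := 'rV[R]_d.
Implicit Types (f g : point -> R) (v x : point).

(** Polynomial functions of total degree at most [k], generated inductively instead of by
    coefficients, so that shifts, differences, derivatives and restrictions to lines are each
    handled by one induction. *)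
Inductive poly_le : nat -> (point -> R) -> Prop :=
| poly_le_cst k c : poly_le k (fun=> c)
| poly_le_coord k j f : poly_le k f -> poly_le k.+1 (fun x => x ord0 j * f x)
| poly_leD k f g : poly_le k f -> poly_le k g -> poly_le k (fun x => f x + g x).

Lemma poly_le_ext k f g : f =1 g -> poly_le k f -> poly_le k g.
Proof. by move=> /funext ->. Qed.

Lemma poly_le_scale k (c : R) f : poly_le k f -> poly_le k (fun x => c * f x).
Proof.
elim=> {k f} [k c'|k j f _ ih|k f g _ ihf _ ihg]; first exact: poly_le_cst.
- by apply: poly_le_ext (poly_le_coord j ih) => x; rewrite mulrCA.
- by apply: poly_le_ext (poly_leD ihf ihg) => x; rewrite mulrDr.
Qed.

Lemma poly_le_leq k l f : (k <= l)%N -> poly_le k f -> poly_le l f.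
Proof.
move=> kl pf; elim: pf l kl => {k f} [k c|k j f _ ih|k f g _ ihf _ ihg] l kl.
- exact: poly_le_cst.
- by case: l kl => // l kl; apply: poly_le_coord; exact: ih.
- by apply: poly_leD; [exact: ihf|exact: ihg].
Qed.

Lemma poly_leM k l f g : poly_le k f -> poly_le l g ->
  poly_le (k + l) (fun x => f x * g x).
Proof.
move=> pf pg; elim: pf => {k f} [k c|k j f _ ih|k f1 f2 _ ih1 _ ih2].
- by apply: (poly_le_leq (leq_addl k l)); exact: poly_le_scale.
- by apply: poly_le_ext (poly_le_coord j ih) => x; rewrite mulrA.
- by apply: poly_le_ext (poly_leD ih1 ih2) => x; rewrite mulrDl.
Qed.

Lemma poly_le_sum (I : finType) (P : pred I) k (F : I -> point -> R) :
  (forall i, P i -> poly_le k (F i)) -> poly_le k (fun x => \sum_(i | P i) F i x).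
Proof.
move=> pF; rewrite (_ : (fun x => _) = \sum_(i | P i) F i); last first.
  by apply/funext => x; rewrite fct_sumE.
elim/big_rec: _ => [|i f Pi pf]; first exact: (poly_le_cst k 0).
exact: poly_leD (pF _ Pi) pf.
Qed.

Lemma poly_le_X j : poly_le 1 (fun x => x ord0 j).
Proof. by apply: poly_le_ext (poly_le_coord j (poly_le_cst 0 1)) => x; rewrite mulr1. Qed.

Lemma poly_le_exp k f a : poly_le k f -> poly_le (k * a) (fun x => f x ^+ a).
Proof.
move=> pf; elim: a => [|a ih]; first exact: poly_le_cst.
by rewrite mulnS; apply: poly_le_ext (poly_leM pf ih) => x; rewrite exprS.
Qed.

Lemma poly_le_monomial (a : 'I_d -> nat) :
  poly_le (\sum_j a j) (fun x => \prod_j x ord0 j ^+ a j).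
Proof.
rewrite (_ : (fun x => _) = \prod_j (fun x => x ord0 j ^+ a j)); last first.
  by apply/funext => x; rewrite fct_prodE.
elim/big_rec2: _ => [|j p k _ pp]; first exact: (poly_le_cst 0 1).
by apply: poly_leM pp; have := poly_le_exp (a j) (poly_le_X j); rewrite mul1n.
Qed.

Lemma polynomial_on_poly_le k (S : set point) f : polynomial_on k S f ->
  exists2 p, poly_le k p & forall x, S x -> f x = p x.
Proof.
move=> [c fE]; exists (fun x => \sum_(a : {ffun 'I_d -> 'I_k.+1} | (\sum_j a j <= k)%N)
            c a * \prod_j x ord0 j ^+ a j); last exact: fE.
apply: poly_le_sum => a ak; apply: poly_le_scale.
exact: poly_le_leq ak (poly_le_monomial _).
Qed.

Lemma poly_le_shift k f v : poly_le k f -> poly_le k (fun x => f (x + v)).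
Proof.
elim=> {k f} [k c|k j f _ ih|k f g _ ihf _ ihg]; first exact: poly_le_cst.
- have := poly_leD (poly_le_coord j ih) (poly_le_leq (leqnSn k) (poly_le_scale (v ord0 j) ih)).
  by apply: poly_le_ext => x; rewrite mxE mulrDl.
- exact: poly_leD.
Qed.

(** Differencing cancels the top-degree part. Since [0.-1 = 0], the degree bound alone would only
    make the difference of a constant a constant; the second conjunct records that it vanishes,
    which the product case of the induction uses. *)
Lemma poly_le_diff k f v : poly_le k f ->
  poly_le k.-1 (fun x => f (x + v) - f x) /\
  (k = 0%N -> forall x, f (x + v) = f x).
Proof.
elim=> {k f} [k c|k j f pf [ih ih0]|k f g _ [ihf ihf0] _ [ihg ihg0]].
- by split=> //; apply: poly_le_ext (poly_le_cst _ 0) => x; rewrite subrr.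
- split=> //=; have := poly_le_scale (v ord0 j) (poly_le_shift v pf).
  case: k pf ih ih0 => [|k] pf ih ih0 /=.
    by apply: poly_le_ext => x; rewrite ih0// mxE; ring.
  by move/(poly_leD (poly_le_coord j ih)); apply: poly_le_ext => x; rewrite mxE; ring.
- split=> [|k0 x]; last by rewrite ihf0// ihg0.
  by apply: poly_le_ext (poly_leD ihf ihg) => x; ring.
Qed.

Lemma poly_le_line k f x v : poly_le k f ->
  exists p : {poly R}, forall s, f (x + s *: v) = p.[s].
Proof.
elim=> {k f} [k c|k j f _ [p pE]|k f g _ [p pE] _ [q qE]].
- by exists c%:P => s; rewrite hornerC.
- exists (((x ord0 j)%:P + v ord0 j *: 'X) * p) => s.
  by rewrite pE !hornerE !mxE; ring.
- by exists (p + q) => s; rewrite hornerD pE qE.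
Qed.

(** On the line through [x], [f] minus its value at [x] is a univariate polynomial with every
    natural number as a root, hence zero. *)
Lemma poly_le_periodic k f x v : poly_le k f ->
  (forall a : nat, f (x + a%:R *: v) = f x) -> forall s, f (x + s *: v) = f x.
Proof.
move=> /poly_le_line-/(_ x v)[p pE] per s.
suff : p - (f x)%:P = 0 by move/eqP; rewrite subr_eq0 pE => /eqP->; rewrite hornerC.
apply/eqP/negPn/negP => p0.
have := max_poly_roots p0 (rs := [seq a%:R | a <- iota 0 (size (p - (f x)%:P))]).
rewrite size_map size_iota ltnn => h; apply/notF/h.
  by apply/allP => _ /mapP[a _ ->]; rewrite rootE !hornerE -pE per subrr.
by rewrite map_inj_uniq ?iota_uniq//; exact: mulrIn (oner_neq0 _).
Qed.

(* Finite differences lower the degree, so by induction they vanish and the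
   polynomial is periodic along the lattice, hence constant. *)
Lemma poly_le_lattice k f q n (u : 'I_n -> point) : poly_le k f ->
  (forall a : 'I_n -> nat, (\sum_j a j <= k)%N -> f (q + \sum_j (a j)%:R *: u j) = 0) ->
  forall s : 'I_n -> R, f (q + \sum_j s j *: u j) = 0.
Proof.
elim: k f => [|k ih] f pf f0 s; last first.
  have per j s' : f (q + \sum_l s' l *: u l + u j) = f (q + \sum_l s' l *: u l).
    apply/eqP; rewrite -subr_eq0; apply/eqP.
    apply: (ih (fun x => f (x + u j) - f x)).
      by have [] := poly_le_diff (u j) pf.
    move=> a ak; rewrite (f0 a (leqW ak)) subr0.
    have -> : q + \sum_l (a l)%:R *: u l + u j =
              q + \sum_l (a l + (l == j))%:R *: u l.
      rewrite -addrA; congr (_ + _).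
      under [RHS]eq_bigr do rewrite natrD scalerDl.
      rewrite big_split/=; congr (_ + _).
      rewrite (bigD1 j)//= eqxx scale1r big1 ?addr0// => l /negPf->.
      by rewrite scale0r.
    apply: f0; rewrite big_split/= -[k.+1]addn1 leq_add//.
    by rewrite (bigD1 j)//= eqxx big1// => l /negPf->.
  have cst j s' t : f (q + \sum_l s' l *: u l + t *: u j) = f (q + \sum_l s' l *: u l).
    apply: poly_le_periodic pf _ _ => a.
    elim: a => [|a iha]; first by rewrite scale0r addr0.
    rewrite -iha -natr1 scalerDl scale1r addrA.
    have -> : q + \sum_l s' l *: u l + a%:R *: u j =
              q + \sum_l (s' l + (if l == j then a%:R else 0)) *: u l.
      rewrite -addrA; congr (_ + _).
      under [RHS]eq_bigr do rewrite scalerDl.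
      rewrite big_split/=; congr (_ + _).
      rewrite [RHS](bigD1 j)//= eqxx big1 ?addr0// => l /negPf->.
      by rewrite scale0r.
    exact: per.
  have f00 : f q = 0.
    have := f0 (fun=> 0%N); rewrite big1// => /(_ (leq0n _)).
  by rewrite big1 ?addr0// => *; exact: scale0r.
  (* The coordinates of [s] are switched on one at a time: at stage [c] only the first [c] are
     present, and [cst] shows that each switch preserves the value. *)
  suff /(_ n (leqnn n)) : forall c : nat, (c <= n)%N ->
      f (q + \sum_(j < n) (if (j < c)%N then s j else 0) *: u j) = 0.
    by under eq_bigr do rewrite ltn_ord.
  elim=> [_|c ihc cn]; first by rewrite big1 ?addr0// => *; rewrite scale0r.
  apply: eq_trans (ihc (ltnW cn)); apply: eq_trans (cst (Ordinal cn) _ (s (Ordinal cn))).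
  congr f; rewrite -addrA; congr (_ + _).
  rewrite (bigD1 (Ordinal cn))//= ltnSn [in RHS](bigD1 (Ordinal cn))//= ltnn scale0r add0r addrC.
  congr (_ + _); apply: eq_bigr => j jc; rewrite ltnS leq_eqVlt.
  by rewrite (_ : (nat_of_ord j == c) = false)//; apply/negbTE.
have f00 : f q = 0.
  have := f0 (fun=> 0%N); rewrite big1// => /(_ (leq0n _)).
  by rewrite big1 ?addr0// => *; exact: scale0r.
have [_ /(_ erefl)] := poly_le_diff (\sum_j s j *: u j) pf.
by move=> ->.
Qed.

End polynomial_functions.

(** * Continuity, derivatives and measurability of polynomial functions; open sets in the product
    sigma-algebra *)

Section polynomial_analysis.
Context {R : realType} {d : nat}.
Local Notation point := 'rV[R]_d.
Implicit Types (f g : point -> R) (v x : point).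

Lemma poly_le_continuous k f : poly_le k f -> continuous f.
Proof.
elim=> {k f} [k c|k j f _ ih|k f g _ ihf _ ihg] x; first exact: cst_continuous.
- by apply: continuousM; [exact: coord_continuous|exact: ih].
- by apply: continuousD; [exact: ihf|exact: ihg].
Qed.

Lemma poly_le_measurable k f (D : set point) : poly_le k f -> measurable_fun D f.
Proof.
move=> pf; apply: (@measurable_funS _ _ _ _ setT) => //.
elim: pf => {k f} [k c|k j f _ ih|k f g _ ihf _ ihg]; first exact: measurable_cst.
- by apply: measurable_funM => //; exact: measurable_rV_coord.
- exact: measurable_funD.
Qed.

Lemma poly_le_bounded k f (r : R) : poly_le k f ->
  exists B : R, forall x, (forall j, `|x ord0 j| <= r) -> `|f x| <= B.
Proof.
elim=> {k f} [k c|k j f _ [B fB]|k f g _ [B fB] _ [C gC]].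
- by exists `|c|.
- by exists (r * B) => x xr; rewrite normrM ler_pM// fB.
- exists (B + C) => x xr; rewrite (le_trans (ler_normD _ _))// lerD ?fB ?gC//.
Qed.

(** The degree bound on the derivative is not sharp; what matters is that it is again polynomial,
    hence measurable and bounded on bounded sets. *)
Lemma poly_le_derivable k f v : poly_le k f ->
  (forall x, derivable f x v) /\ poly_le k (fun x => 'D_v f x).
Proof.
elim=> {k f} [k c|k j f pf [df pdf]|k f g _ [df pdf] _ [dg pdg]].
- split=> [x|]; first exact: derivable_cst.
  by apply: poly_le_ext (poly_le_cst k 0) => x; rewrite (derive_cst c).
- have dX x : derivable (fun y : point => y ord0 j : R) x v.
    exact/diff_derivable/differentiable_coord.
  have vX x : 'D_v (fun y : point => y ord0 j : R) x = v ord0 j.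
    apply: cvg_lim => //; apply: cvg_near_cst; near=> h.
    rewrite /= !mxE addrK /GRing.scale/= mulKf//.
    by near: h; exact: nbhs_dnbhs_neq.
  split=> [x|]; first exact: derivableM.
  have := poly_leD (poly_le_coord j pdf) (poly_le_leq (leqnSn k) (poly_le_scale (v ord0 j) pf)).
  apply: poly_le_ext => x; rewrite deriveM// vX; congr (_ + _); exact: mulrC.
- split=> [x|]; first exact: derivableD.
  by apply: poly_le_ext (poly_leD pdf pdg) => x; rewrite deriveD.
Unshelve. all: by end_near. Qed.

(** An open set is the countable union of the cubes with rational centre and radius [1/(n+1)] that
    it contains, and cubes are finite intersections of coordinate preimages. *)
Lemma open_measurable_rV (U : set point) : open U -> measurable U.
Proof.
move=> oU.
pose B (p : {ffun 'I_d -> rat} * nat) : set point :=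
  [set x | forall j, `|x ord0 j - ratr (p.1 j)| < p.2.+1%:R^-1].
have mB p : measurable (B p).
  rewrite (_ : B p = \bigcap_(j in setT) (@rV_coord R d j @^-1` ball (ratr (p.1 j) : R) p.2.+1%:R^-1)).
    apply: fin_bigcap_measurable => // j _.
    rewrite -[X in measurable X]setTI; apply: measurable_rV_coord => //.
    exact: measurable_ball.
  apply/seteqP; split=> x /= Bx j; first by move=> _; rewrite /ball/= distrC; exact: Bx.
  by have := Bx j I; rewrite /ball/= distrC.
rewrite (_ : U = \bigcup_(p in [set p | B p `<=` U]) B p); last first.
  apply/seteqP; split=> [x Ux|x [p /= pU /pU//]].
  have /nbhs_ballP[e /= e0 eU] := open_nbhs_nbhs (conj oU Ux).
  (* Two points of a cube of radius [1/(n+1)] are less than [2/(n+1)] apart, and this choice brings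
     that below [e]. *)
  pose n := Num.truncn (2 / e).
  have ne : 2 * n.+1%:R^-1 < e.
    by rewrite ltr_pdivrMr// mulrC -ltr_pdivrMr// truncnS_gt.
  have qP j : exists q : rat, `|x ord0 j - ratr q| < n.+1%:R^-1.
    have [|q] := @rat_in_itvoo R (x ord0 j - n.+1%:R^-1) (x ord0 j + n.+1%:R^-1).
      by rewrite ltrBlDr -addrA ltrDl addr_gt0// invr_gt0.
    by rewrite in_itv/= => qx; exists q; rewrite ltr_distlC.
  have [q qE] := choice qP.
  exists ([ffun j => q j], n); last by move=> j /=; rewrite ffunE.
  move=> y /= By; apply: eU; split=> // i j; rewrite (ord1 i) /ball/=.
  have := By j; rewrite ffunE /= => yq; have xq := qE j.
  rewrite (le_lt_trans _ ne)//.
  have -> : x ord0 j - y ord0 j =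
      (x ord0 j - ratr (q j)) - (y ord0 j - ratr (q j)) by ring.
  by rewrite (le_trans (ler_normB _ _))// mulr_natl mulr2n lerD// ltW.
rewrite bigcup_mkcond; apply: countable_bigcupT_measurable => [|p].
  exact: countableP.
by case: ifP.
Qed.

Lemma rV_coord_le_norm x j : `|x ord0 j| <= `|x|.
Proof.
by rewrite [leRHS]/Num.norm /= mx_normrE; apply/bigmax_geP; right => /=; exists (ord0, j).
Qed.

(** The set fits into a cube of finite measure. [bounded_set] bounds the norm only by numbers
    strictly above [r], whence the half-side [r + 1]. *)
Lemma bounded_lebesgue_rV_lty (U : set point) : open U -> bounded_set U ->
  (lebesgue_rV d U < +oo)%E.
Proof.
move=> oU [r [_ /(_ (r + 1))]]; rewrite ltrDl ltr01 => /(_ isT) Ur.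
apply: (@le_lt_trans _ _ (lebesgue_rV d
    [set x | forall j, [set` `[(- (r + 1)), (r + 1)]] (x ord0 j)])).
  apply: le_measure; rewrite ?inE.
  - exact: open_measurable_rV.
  - rewrite [X in measurable X](_ : _ = \bigcap_(j in setT)
        (@rV_coord R d j @^-1` [set` `[(- (r + 1)), (r + 1)]])).
      apply: fin_bigcap_measurable => // j _.
      by rewrite -[X in measurable X]setTI; exact: measurable_rV_coord.
    by apply/seteqP; split=> x /= Bx j; [move=> _; exact: Bx|exact: Bx].
  - move=> x Ux j /=; rewrite in_itv/= -ler_norml.
    exact: le_trans (rV_coord_le_norm x j) (Ur x Ux).
rewrite (lebesgue_rV_box (B := fun=> [set` `[(- (r + 1)), (r + 1)]]))//.
have /andP[] : (0 <= \prod_(j < d) @lebesgue_measure R [set` `[(- (r + 1))%R, (r + 1)%R]] < +oo)%E.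
  elim/big_ind: _ => [|a b /andP[a0 aoo] /andP[b0 boo]|j _]; first by rewrite lee01 ltry.
    by rewrite mule_ge0// lte_mul_pinfty// ge0_fin_numE.
  by rewrite measure_ge0/= lebesgue_measure_itv/=; case: ifP => _ //; exact: ltry.
by [].
Qed.

End polynomial_analysis.

(** * Simplices and meshes *)

Section barycentric.
Context {R : realType} {d : nat}.
Local Notation point := 'rV[R]_d.
Variable p : 'I_d.+1 -> point.

Definition edge_mx : 'M[R]_d := \matrix_(i < d) (p (lift ord0 i) - p ord0).

Lemma affine_comb_edge (t : 'I_d.+1 -> R) : \sum_i t i = 1 ->
  \sum_i t i *: p i =
  p ord0 + \sum_(j < d) t (lift ord0 j) *: (p (lift ord0 j) - p ord0).
Proof.
rewrite !big_ord_recl => t1; under [in RHS]eq_bigr do rewrite scalerBr.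
rewrite sumrB -scaler_suml addrCA [RHS]addrC; congr (_ + _).
by rewrite -[X in X - _]scale1r -scalerBl -t1 addrK.
Qed.

Lemma mul_edge_mx (s : 'rV[R]_d) :
  s *m edge_mx = \sum_j s ord0 j *: (p (lift ord0 j) - p ord0).
Proof. by rewrite mulmx_sum_row; apply: eq_bigr => j _; rewrite rowK. Qed.

(** Barycentric coordinates at an arbitrary point: the coefficients of [x - p ord0] in the basis of
    edges, with the remaining weight given to the vertex [p ord0]. *)
Definition bary (i : 'I_d.+1) (x : point) : R :=
  let s := (x - p ord0) *m invmx edge_mx in
  if unlift ord0 i is Some j then s ord0 j else 1 - \sum_j s ord0 j.

Lemma bary_poly_le i : poly_le 1 (bary i).
Proof.
have sP j : poly_le 1 (fun x => ((x - p ord0) *m invmx edge_mx) ord0 j).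
  apply: (@poly_le_ext _ _ _ (fun x => \sum_l
      invmx edge_mx l j * (x ord0 l + - p ord0 ord0 l))).
    by move=> x; rewrite mxE; apply: eq_bigr => l _; rewrite !mxE mulrC.
  apply: poly_le_sum => l _; apply: poly_le_scale; apply: poly_leD.
    exact: poly_le_X.
  exact: poly_le_cst.
rewrite /bary; case: unliftP => [j _|_]; first exact: sP.
apply: (@poly_le_ext _ _ _ (fun x => 1 + \sum_j
    -1 * ((x - p ord0) *m invmx edge_mx) ord0 j)).
  by move=> x; rewrite -mulr_sumr mulN1r.
apply: poly_leD; first exact: poly_le_cst.
by apply: poly_le_sum => j _; exact: poly_le_scale.
Qed.

Lemma bary_sum x : \sum_i bary i x = 1.
Proof.
rewrite big_ord_recl /bary unlift_none; under [X in _ + X]eq_bigr do rewrite liftK.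
by rewrite subrK.
Qed.

Hypothesis p_nondegenerate : edge_mx \in unitmx.

Lemma bary_comb x : \sum_i bary i x *: p i = x.
Proof.
rewrite (affine_comb_edge (bary_sum x)) /bary.
under eq_bigr do rewrite liftK.
by rewrite -mul_edge_mx mulmxKV// addrC subrK.
Qed.

Lemma bary_affine (t : 'I_d.+1 -> R) i : \sum_j t j = 1 ->
  bary i (\sum_j t j *: p j) = t i.
Proof.
move=> t1; rewrite (affine_comb_edge t1) /bary addrC addKr.
have -> : \sum_(j < d) t (lift ord0 j) *: (p (lift ord0 j) - p ord0) =
    (\row_j t (lift ord0 j)) *m edge_mx.
  by rewrite mul_edge_mx; apply: eq_bigr => j _; rewrite mxE.
rewrite mulmxK//; case: unliftP => [j|] ->; first by rewrite mxE.
by under eq_bigr do rewrite mxE; rewrite -t1 big_ord_recl addrK.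
Qed.

(** Barycentric coordinates are continuous, so they stay positive near [x], and [bary_comb] then
    writes the nearby points as convex combinations of the vertices. *)
Lemma bary_gt0_interior x : (forall i, 0 < bary i x) -> (simplex p)° x.
Proof.
move=> x0; have : \forall y \near x, forall i, 0 < bary i y.
  apply: (@filter_forall point _ (fun i => [set y | 0 < bary i y]) (nbhs x) _) => i.
  exact: @cvgr_gt _ _ (nbhs x) _ (bary i) _
    (poly_le_continuous (bary_poly_le i) (x := x)) _ (x0 i).
apply: filterS => y y0; exists (bary^~ y); split=> //.
- by move=> i; exact/ltW.
- exact: bary_sum.
- by rewrite bary_comb.
Qed.

(** A small move from [x] towards the centroid stays in [U] and makes every barycentric coordinate
    positive. *)
Lemma open_meets_simplex (U : set point) x : open U -> U x -> simplex p x ->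
  exists2 z, U z & forall i, 0 < bary i z.
Proof.
move=> oU Ux [t [t0 _ t1 xE]].
have /nbhs_ballP[e /= e0 eU] := open_nbhs_nbhs (conj oU Ux).
pose n : R := d.+1%:R.
have n0 : 0 < n by rewrite ltr0n.
pose c := n^-1 *: \sum_i p i.
have D0 : 0 < `|c - x| + 1 + e by rewrite ltr_wpDl// addr_ge0.
(* The denominator exceeds both [e] and the distance to the centroid, so that [s < 1] and the
   displacement is shorter than [e]. *)
pose s := e / (`|c - x| + 1 + e).
have s0 : 0 < s by rewrite divr_gt0.
have s1 : s < 1 by rewrite ltr_pdivrMr// mul1r ltrDr ltr_wpDl.
pose t' i := (1 - s) * t i + s * n^-1.
have t'1 : \sum_i t' i = 1.
  rewrite big_split/= -!mulr_sumr t1 sumr_const card_ord -mulr_natr mulVf ?gt_eqF//.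
  by rewrite !mulr1 subrK.
exists (\sum_i t' i *: p i); last first.
  move=> i; rewrite bary_affine// /t' ltr_wpDl//; last by rewrite mulr_gt0// invr_gt0.
  by rewrite mulr_ge0// subr_ge0 ltW.
apply: eU; rewrite -ball_normE/=.
have -> : \sum_i t' i *: p i = x + s *: (c - x).
  under eq_bigr do rewrite scalerDl -!scalerA.
  rewrite big_split/= -!scaler_sumr [X in _ + X]scalerA -/s -/c.
  by rewrite -xE scalerBl scale1r scalerBr addrAC addrA.
rewrite opprD addNKr normrN normrZ gtr0_norm// /s mulrAC ltr_pdivrMr// ltr_pM2l//.
by rewrite -addrA ltrDl addr_gt0.
Qed.

End barycentric.

(** * Elements versus resolved subdomains, and unisolvence of the Lagrange nodes *)

Section mesh.
Context {R : realType} {d : nat} {I : finType}.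
Local Notation point := 'rV[R]_d.
Variables (Omega : set point) (T : I -> 'I_d.+1 -> point) (k : nat).
Hypothesis hT : triangulation Omega T.

Lemma resolved_open (w : set point) : resolved T w -> open w.
Proof. by move=> [J ->]; exact: open_interior. Qed.

(** No element straddles the boundary of a resolved set. A point [z] of [w] with positive
    barycentric coordinates in [K] lies in some element [K'] of the union defining [w]; by
    conformity [z] is in the face spanned by the common vertices, so positivity makes every vertex
    of [K] a vertex of [K']. *)
Lemma resolved_interior (w : set point) K x : resolved T w ->
  (simplex (T K))° x -> w x -> (simplex (T K))° `<=` w.
Proof.
move=> rw Kx wx; have ow := resolved_open rw.
have nK := mesh_nondegenerate hT K.
have [z wz z0] := open_meets_simplex nK ow wx (interior_subset Kx).
case: rw => J wE; move: (wz); rewrite wE => /interior_subset[K' K'J K'z].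
have Kz : simplex (T K) z := interior_subset (bary_gt0_interior nK z0).
have : (simplex (T K) `&` simplex (T K')) z by [].
rewrite (mesh_conforming hT) => -[t [t0 tN t1 zE]].
have allK i : range (T K') (T K i).
  apply: contrapT => /tN ti0; have := z0 i.
  by rewrite zE (bary_affine nK)// ti0 ltxx.
have KK' : simplex (T K) `<=` simplex (T K').
  move=> y Ky; suff [] : (simplex (T K) `&` simplex (T K')) y by [].
  rewrite (mesh_conforming hT); case: Ky => u [u0 _ u1 yE].
  by exists u; split=> // i /(_ (allK i)).
by apply: interiorS; apply: subset_trans KK' _ => y K'y; exists K'.
Qed.

(* Only nodes inside Omega matter, since v vanishes at those on the boundary. *)
Lemma Vh_unisolvent v K : (0 < k)%N -> Vh Omega T k v ->
  (forall x, lagrange_node T k x -> Omega x -> simplex (T K) x -> v x = 0) ->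
  forall x, simplex (T K) x -> v x = 0.
Proof.
move=> k0 [_ vO /(_ K)/polynomial_on_poly_le[f pf vf]] v0 x Kx.
rewrite (vf _ Kx); case: Kx => t [t0 _ t1 ->]; rewrite (affine_comb_edge (T K) t1).
have k0' : k%:R != 0 :> R by rewrite pnatr_eq0 -lt0n.
(* With edges divided by [k], the nodes are the lattice points [T K ord0 + \sum_j (a j)%:R *: u j]
   with [\sum_j a j <= k]. Below, [b] completes [a] to weights of sum [k], the first vertex
   receiving the remainder. *)
pose u j := k%:R^-1 *: (T K (lift ord0 j) - T K ord0).
have -> : \sum_(j < d) t (lift ord0 j) *: (T K (lift ord0 j) - T K ord0) =
    \sum_j (k%:R * t (lift ord0 j)) *: u j.
  by apply: eq_bigr => j _; rewrite scalerA mulrAC mulfV// mul1r.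
apply: (poly_le_lattice (u := u) pf) => a ak.
pose b (i : 'I_d.+1) : nat := if unlift ord0 i is Some j then a j else (k - \sum_j a j)%N.
have bk : (\sum_i b i = k)%N.
  rewrite big_ord_recl /b unlift_none; under [X in (_ + X)%N]eq_bigr do rewrite liftK.
  by rewrite subnK.
have b1 : \sum_i (b i)%:R / k%:R = 1 :> R.
  by rewrite -mulr_suml -natr_sum bk mulfV.
pose y := \sum_i ((b i)%:R / k%:R) *: T K i.
have -> : T K ord0 + \sum_j (a j)%:R *: u j = y.
  rewrite /y (affine_comb_edge (T K) b1); congr (_ + _); apply: eq_bigr => j _.
  by rewrite /b liftK scalerA.
have Ky : simplex (T K) y.
  by exists (fun i => (b i)%:R / k%:R); split=> // i; rewrite divr_ge0.
rewrite -vf//; have [Oy|/vO//] := pselect (Omega y).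
by apply: v0 => //; exists K, b.
Qed.

End mesh.

(** * Positive semidefinite forms and eigenbases *)

Section forms.
Context {R : realType} {V : lmodType R}.
Implicit Types (X W : set V) (a b : V -> V -> R).

Definition linear_subspace X := X 0 /\ forall c u v, X u -> X v -> X (c *: u + v).

(** The axioms are relative to a set [X] because an energy is known to be additive only where the
    integrands are integrable. Linearity in the second argument follows from symmetry. *)
Record psd_form X a : Prop := {
  psd_linear : forall c u v z, X u -> X v -> X z ->
    a (c *: u + v) z = c * a u z + a v z ;
  psd_sym : forall u v, X u -> X v -> a u v = a v u ;
  psd_ge0 : forall u, X u -> 0 <= a u u }.

Section theory.
Variables (X : set V) (a : V -> V -> R).
Hypotheses (sX : linear_subspace X) (pa : psd_form X a).

Lemma subspaceZ c u : X u -> X (c *: u).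
Proof. by move=> Xu; rewrite -[_ *: _]addr0; apply: sX.2 => //; exact: sX.1. Qed.

Lemma subspaceD u v : X u -> X v -> X (u + v).
Proof. by move=> Xu Xv; rewrite -[u]scale1r; apply: sX.2. Qed.

Lemma subspaceB u v : X u -> X v -> X (u - v).
Proof. by move=> Xu Xv; rewrite addrC -scaleN1r; apply: sX.2. Qed.

Lemma subspace_sum (I : finType) (P : pred I) (f : I -> V) :
  (forall i, P i -> X (f i)) -> X (\sum_(i | P i) f i).
Proof. by move=> Xf; elim/big_ind: _; [exact: sX.1|exact: subspaceD|]. Qed.

Lemma psd_formDl u v z : X u -> X v -> X z -> a (u + v) z = a u z + a v z.
Proof. by move=> Xu Xv Xz; rewrite -[u]scale1r (psd_linear pa)// mul1r scale1r. Qed.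

Lemma psd_form0l z : X z -> a 0 z = 0.
Proof.
move=> Xz; have := psd_formDl sX.1 sX.1 Xz.
by rewrite addr0 => /eqP; rewrite -subr_eq0 opprD addNKr oppr_eq0 => /eqP.
Qed.

Lemma psd_formZl c u z : X u -> X z -> a (c *: u) z = c * a u z.
Proof.
move=> Xu Xz; rewrite -[_ *: _]addr0 (psd_linear pa)// ?psd_form0l ?addr0//.
exact: sX.1.
Qed.

Lemma psd_formBl u v z : X u -> X v -> X z -> a (u - v) z = a u z - a v z.
Proof.
by move=> Xu Xv Xz; rewrite addrC -scaleN1r (psd_linear pa)// mulN1r addrC.
Qed.

Lemma psd_formBr u v z : X u -> X v -> X z -> a z (u - v) = a z u - a z v.
Proof.
move=> Xu Xv Xz; rewrite (psd_sym pa)//; last exact: subspaceB.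
by rewrite psd_formBl// !(psd_sym pa Xz).
Qed.

Lemma psd_form_suml (I : finType) (P : pred I) (c : I -> R) (f : I -> V) z :
  (forall i, X (f i)) -> X z ->
  a (\sum_(i | P i) c i *: f i) z = \sum_(i | P i) c i * a (f i) z.
Proof.
(* Membership in [X] is carried along the induction, since linearity is conditional on it. *)
move=> Xf Xz; pose Q u (r : R) := X u /\ a u z = r.
suff [] : Q (\sum_(i | P i) c i *: f i) (\sum_(i | P i) c i * a (f i) z) by [].
elim/big_rec2: _ => [|i r u _ [Xu <-]]; split; rewrite ?psd_form0l//; first exact: sX.1.
- exact: sX.2.
- exact: (psd_linear pa).
Qed.

Lemma psd_form_sum (I : finType) (P Q : pred I) (c : I -> R) (f : I -> V) :
  (forall i, X (f i)) ->
  a (\sum_(i | P i) c i *: f i) (\sum_(i | Q i) c i *: f i) =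
  \sum_(i | P i) \sum_(j | Q j) c i * c j * a (f i) (f j).
Proof.
move=> Xf; have Xs (S : pred I) : X (\sum_(i | S i) c i *: f i).
  by apply: subspace_sum => i _; exact: subspaceZ.
rewrite psd_form_suml//; apply: eq_bigr => i _.
rewrite (psd_sym pa)// psd_form_suml// mulr_sumr; apply: eq_bigr => j _.
by rewrite mulrA (psd_sym pa).
Qed.

Lemma psd_form_pythagoras u v : X u -> X v -> a u v = 0 ->
  a (u + v) (u + v) = a u u + a v v.
Proof.
move=> Xu Xv uv; have Xuv := subspaceD Xu Xv.
rewrite psd_formDl// !(psd_sym pa _ Xuv)// !psd_formDl//.
by rewrite (psd_sym pa Xv Xu) uv addr0 add0r.
Qed.

Lemma psd_form_null u v : X u -> X v -> a u u = 0 -> a u v = 0.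
Proof.
move=> Xu Xv u0; apply/eqP/negPn/negP => uv0.
(* As [a u u = 0], the form at [t *: u + v] is affine in [t]; this [t] gives it the value -1,
   against positivity. *)
pose t := - (a v v + 1) / (2 * a u v).
have := psd_ge0 pa (sX.2 t _ _ Xu Xv).
have Xtv := sX.2 t _ _ Xu Xv.
rewrite (psd_linear pa)// !(psd_sym pa _ Xtv)// !(psd_linear pa)//.
rewrite (psd_sym pa Xv Xu) u0 mulr0 add0r.
have -> : t * a u v + (t * a u v + a v v) = -1 by rewrite /t; field.
by rewrite oppr_ge0 ler10.
Qed.

(** Positivity at [u - v] and [u + v] gives the two signs. This arithmetic-mean bound plays the part
    of Cauchy-Schwarz. *)
Lemma psd_form_norm_le u v : X u -> X v -> `|a u v| <= (a u u + a v v) / 2.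
Proof.
move=> Xu Xv; have Xd := subspaceB Xu Xv; have Xs := subspaceD Xu Xv.
have := psd_ge0 pa Xd; rewrite psd_formBl// !psd_formBr// (psd_sym pa Xv Xu) => h1.
have := psd_ge0 pa Xs; rewrite psd_formDl// !(psd_sym pa _ Xs)// !psd_formDl//.
rewrite (psd_sym pa Xv Xu) => h2.
by rewrite ler_norml; apply/andP; split; lra.
Qed.

(** Each cross term is bounded by the mean of two diagonal ones, and every diagonal term is then
    counted [#|J|] times. Applied pointwise to gradients, this produces the factor [xi]. *)
Lemma psd_form_sum_le (I : finType) (J : {set I}) (f : I -> V) :
  (forall i, X (f i)) ->
  a (\sum_(i in J) f i) (\sum_(i in J) f i) <= #|J|%:R * \sum_(i in J) a (f i) (f i).
Proof.
move=> Xf; have E : \sum_(i in J) f i = \sum_(i in J) (fun=> 1) i *: f i.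
  by apply: eq_bigr => i _; rewrite scale1r.
rewrite E psd_form_sum//.
pose q i := a (f i) (f i).
apply: (@le_trans _ _ (\sum_(i in J) \sum_(j in J) (q i + q j) / 2)).
  apply: ler_sum => i _; apply: ler_sum => j _; rewrite !mul1r.
  exact: le_trans (ler_norm _) (psd_form_norm_le (Xf i) (Xf j)).
rewrite le_eqVlt; apply/orP; left; apply/eqP.
under eq_bigr do rewrite -mulr_suml big_split/= sumr_const.
rewrite -mulr_suml big_split/= sumr_const sumrMnl -mulr_natl.
by field.
Qed.

End theory.
End forms.

(** * Spectral estimate for the tail of an eigenbasis expansion *)

Section spectral.
Context {R : realType} {d : nat}.
Local Notation fct := ('rV[R]_d -> R).
Variables (X W : set fct) (a b : fct -> fct -> R) (n : nat).
Variables (lam : nat -> \bar R) (phi : nat -> fct).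
Hypotheses (sX : linear_subspace X) (WX : W `<=` X).
Hypotheses (pa : psd_form X a) (pb : psd_form X b).
Hypothesis eig : eigenbasis W b a n lam phi.

Lemma eigenbasis_mem l : (l < n)%N -> W (phi l).
Proof.
move=> ln; rewrite (eig_span eig); exists (fun j => (j == Ordinal ln)%:R) => //.
rewrite (bigD1 (Ordinal ln))//= eqxx scale1r big1 ?addr0// => j /negPf->.
by rewrite scale0r.
Qed.

(** [eig_orthogonal] covers finite eigenvalues; an eigenfunction with eigenvalue [+oo] lies in the
    kernel of [a] and is orthogonal to everything in [W]. *)
Lemma eigenbasis_orthogonal l l' : (l < n)%N -> (l' < n)%N -> l != l' ->
  a (phi l) (phi l') = 0.
Proof.
move=> ln l'n ll'; have [Wl Wl'] := (eigenbasis_mem ln, eigenbasis_mem l'n).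
have [/(eig_kernel eig ln) h|loo] := eqVneq (lam l) +oo%E; first exact: h.
have [/(eig_kernel eig l'n) h|l'oo] := eqVneq (lam l') +oo%E.
  by rewrite (psd_sym pa) ?h//; exact: WX.
by apply: (eig_orthogonal eig) => //; rewrite ltey.
Qed.

(** For a finite eigenvalue [a (phi l) (phi l)] is positive, as otherwise [psd_form_null] would put
    [phi l] in the kernel; the Rayleigh quotient is then nonnegative. *)
Lemma eigenvalue_ge0 l : (l < n)%N -> (0 <= lam l)%E.
Proof.
move=> ln; have Wl := eigenbasis_mem ln; have Xl := WX Wl.
case lamE : (lam l) => [r| |]; last 2 first.
- exact: le0y.
- by have := eig_range eig ln; rewrite lamE.
have al : 0 < a (phi l) (phi l).
  rewrite lt0r (psd_ge0 pa)// andbT; apply/eqP => al0.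
  suff : lam l = +oo%E by rewrite lamE.
  apply/(eig_kernel eig ln) => v Wv; apply: (psd_form_null sX pa) => //; exact: WX.
have := psd_ge0 pb Xl; rewrite (eig_eq eig ln lamE)//.
by rewrite pmulr_lge0// lee_fin.
Qed.

Lemma next_eigenvalue_ge0 m : (0 <= next_eigenvalue n m lam)%E.
Proof. by rewrite /next_eigenvalue; case: ifP => // /eigenvalue_ge0. Qed.

(** Orthogonality for [a] passes to [b] through the eigenvalue equation, so both sides become
    diagonal sums. Tail terms compare one by one, and the head only adds nonnegative terms on the
    right. *)
Lemma eigenbasis_tail_le m (r : R) (c : 'I_n -> R) :
  (next_eigenvalue n m lam <= r%:E)%E ->
  b (\sum_(l < n | (m <= l)%N) c l *: phi l) (\sum_(l < n | (m <= l)%N) c l *: phi l)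
  <= r * a (\sum_(l < n) c l *: phi l) (\sum_(l < n) c l *: phi l).
Proof.
move=> mr; have Xphi (l : 'I_n) : X (phi l) by exact/WX/eigenbasis_mem.
have r0 : 0 <= r by rewrite -lee_fin (le_trans (next_eigenvalue_ge0 m)).
(* Counting starts at 0, so [lam m] is the largest eigenvalue of the tail; the finite bound [r] on
   it excludes [+oo]. *)
have lamE (l : 'I_n) : (m <= l)%N -> exists2 s, lam l = s%:E & s <= r.
  move=> ml; have mn := leq_ltn_trans ml (ltn_ord l).
  have lr : (lam l <= r%:E)%E.
    apply: le_trans mr; rewrite /next_eigenvalue mn; apply: (eig_decreasing eig).
    by rewrite ml ltn_ord.
  have := eigenvalue_ge0 (ltn_ord l); case: (lam l) lr => // s.
  by rewrite lee_fin; exists s.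
rewrite (psd_form_sum sX pb)// (psd_form_sum sX pa)// mulr_sumr.
rewrite [leLHS]big_mkcond/=; apply: ler_sum => l _.
have -> : \sum_(j < n) c l * c j * a (phi l) (phi j) = c l ^+ 2 * a (phi l) (phi l).
  rewrite (bigD1 l)//= big1 ?addr0// => j jl.
  by rewrite eigenbasis_orthogonal ?mulr0// eq_sym.
have al0 := psd_ge0 pa (Xphi l).
case: ifPn => [ml|_]; last by rewrite mulr_ge0// mulr_ge0// sqr_ge0.
have [s lE sr] := lamE l ml.
rewrite (bigD1 l)//= big1 ?addr0 => [|j /andP[_ jl]].
  rewrite (eig_eq eig (ltn_ord l) lE); last exact: eigenbasis_mem.
  by rewrite -expr2 mulrCA ler_wpM2r// mulr_ge0// sqr_ge0.
rewrite (eig_eq eig (ltn_ord l) lE); last exact: eigenbasis_mem.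
by rewrite eigenbasis_orthogonal ?mulr0// eq_sym.
Qed.

End spectral.

(** * The energy form on piecewise polynomials *)

Section mesh_gradient.
Context {R : realType} {d : nat} {I : finType}.
Local Notation point := 'rV[R]_d.
Local Notation fct := ('rV[R]_d -> R).
Variable T : I -> 'I_d.+1 -> point.
Implicit Types (U : set point) (u v : fct).

(** Agreement is asked only inside [U], so that zero extensions of restrictions to [U], which may
    jump across its boundary, are included. *)
Definition piecewise_poly U : set fct := [set v | forall K, exists k f,
  poly_le k f /\ forall x, U x -> simplex (T K) x -> v x = f x].

Lemma piecewise_poly_subspace U : linear_subspace (piecewise_poly U).
Proof.
split=> [|c u v pu pv]; last move=> K.
  by move=> K; exists 0%N, (fun=> 0); split=> [|x _ _ /=]; [exact: poly_le_cst|].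
have [k [f [pf uf]]] := pu K; have [l [g [pg vg]]] := pv K.
exists (maxn k l), (fun x => c * f x + g x); split.
  apply: poly_leD; last exact: poly_le_leq (leq_maxr k l) pg.
  by apply: poly_le_scale; exact: poly_le_leq (leq_maxl k l) pf.
by move=> x Ux Kx; rewrite -uf// -vg.
Qed.

Lemma Vh_piecewise_poly Omega k v U : Vh Omega T k v -> piecewise_poly U v.
Proof.
move=> [_ _ pv] K; have [f pf vf] := polynomial_on_poly_le (pv K).
by exists k, f; split=> // x _; exact: vf.
Qed.

Lemma piecewise_poly_eq U u v : (forall x, U x -> u x = v x) ->
  piecewise_poly U u -> piecewise_poly U v.
Proof.
move=> uv pu K; have [k [f [pf uf]]] := pu K.
by exists k, f; split=> // x Ux; rewrite -uv//; exact: uf.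
Qed.

Lemma mesh_grad_poly U v K k f x : open U -> poly_le k f ->
  (forall y, U y -> simplex (T K) y -> v y = f y) ->
  U x -> (simplex (T K))° x -> mesh_grad T v x = grad f x.
Proof.
move=> oU pf vf Ux Kx; rewrite /mesh_grad patchT; last by rewrite inE; exists K.
apply/rowP => j; rewrite !mxE; apply: near_eq_derive.
have : \forall y \near x, U y by exact: open_nbhs_nbhs.
by move: Kx; apply: filterS2 => y Ky Uy; exact: vf.
Qed.

Lemma mesh_grad_out v x : ~ (\bigcup_K (simplex (T K))°) x -> mesh_grad T v x = 0.
Proof. by move=> Sx; rewrite /mesh_grad patchN// notin_setE. Qed.

Lemma mesh_grad_eq U u v x : open U -> U x -> (forall y, U y -> u y = v y) ->
  mesh_grad T u x = mesh_grad T v x.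
Proof.
move=> oU Ux uv; have [Sx|Sx] := pselect ((\bigcup_K (simplex (T K))°) x); last first.
  by rewrite !mesh_grad_out.
rewrite /mesh_grad !patchT ?inE//; apply/rowP => j; rewrite !mxE.
apply: near_eq_derive; have : \forall y \near x, U y by exact: open_nbhs_nbhs.
exact: filterS.
Qed.

Lemma mesh_grad0 K v x : (forall y, simplex (T K) y -> v y = 0) ->
  (simplex (T K))° x -> mesh_grad T v x = 0.
Proof.
move=> v0 Kx; rewrite (mesh_grad_poly openT (poly_le_cst 0 0) _ _ Kx)//; last first.
  by move=> y _; exact: v0.
by apply/rowP => j; rewrite !mxE; exact: derive_cst.
Qed.

(** The identity holds at every point of [U]: inside elements by differentiating polynomials,
    elsewhere because [mesh_grad] is zero there by convention. *)
Lemma mesh_grad_linear U c u v x : open U -> U x ->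
  piecewise_poly U u -> piecewise_poly U v ->
  mesh_grad T (c *: u + v) x = c *: mesh_grad T u x + mesh_grad T v x.
Proof.
move=> oU Ux pu pv; have [[K _ Kx]|Sx] := pselect ((\bigcup_K (simplex (T K))°) x); last first.
  by rewrite !mesh_grad_out// scaler0 addr0.
have [k [f [pf uf]]] := pu K; have [l [g [pg vg]]] := pv K.
have pfg : poly_le (maxn k l) (fun y => c * f y + g y).
  apply: poly_leD; last exact: poly_le_leq (leq_maxr k l) pg.
  by apply: poly_le_scale; exact: poly_le_leq (leq_maxl k l) pf.
rewrite (mesh_grad_poly oU pf uf)// (mesh_grad_poly oU pg vg)//.
rewrite (mesh_grad_poly oU pfg _ Ux Kx); last by move=> y Uy Ky; rewrite -uf// -vg.
apply/rowP => j; rewrite !mxE /partial.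
have [df _] := poly_le_derivable (delta_mx ord0 j) pf.
have [dg _] := poly_le_derivable (delta_mx ord0 j) pg.
rewrite (_ : (fun y => _) = (c *: f) + g)// deriveD ?deriveZ//.
exact: derivableZ.
Qed.

Lemma mesh_grad_sum U (J : finType) (P : pred J) (f : J -> fct) x : open U -> U x ->
  (forall i, piecewise_poly U (f i)) ->
  mesh_grad T (\sum_(i | P i) f i) x = \sum_(i | P i) mesh_grad T (f i) x.
Proof.
move=> oU Ux pf; have sX := piecewise_poly_subspace U.
have g0 : mesh_grad T (0 : fct) x = 0.
  have := mesh_grad_linear (-1) oU Ux sX.1 sX.1.
  by rewrite scaler0 addr0 scaleN1r addNr.
pose Q u (r : point) := piecewise_poly U u /\ mesh_grad T u x = r.
suff [] : Q (\sum_(i | P i) f i) (\sum_(i | P i) mesh_grad T (f i) x) by [].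
elim/big_rec2: _ => [|i r u _ [pu <-]]; first by split=> //; exact: sX.1.
split; first by apply: (subspaceD sX).
by rewrite -[f i in LHS]scale1r (mesh_grad_linear _ oU)// scale1r.
Qed.

(** [U] splits into a part where the gradient is zero by convention and finitely many open pieces
    where it is a derivative of a polynomial. *)
Lemma measurable_mesh_grad U v j : open U -> piecewise_poly U v ->
  measurable_fun U (fun x => mesh_grad T v x ord0 j).
Proof.
move=> oU pv; pose S := \bigcup_K (simplex (T K))°.
have oS : open S by apply: bigcup_open => K _; exact: open_interior.
have mU := open_measurable_rV oU; have mS := open_measurable_rV oS.
rewrite (_ : U = (U `\` S) `|` (U `&` S)); last by rewrite setUC setUIDK.
apply/measurable_funU; [exact: measurableD|exact: measurableI|split].
  apply: (eq_measurable_fun (cst (0 : R))).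
    by move=> x; rewrite inE => -[_ Sx]; rewrite mesh_grad_out// mxE.
  exact: measurable_cst.
rewrite /S setI_bigcupr.
have mK K : measurable (U `&` (simplex (T K))°).
  by apply: open_measurable_rV; apply: openI => //; exact: open_interior.
move=> _ Y mY; rewrite setI_bigcupl; apply: fin_bigcup_measurable => // K _.
have [k [f [pf vf]]] := pv K.
have [_ pdf] := poly_le_derivable (delta_mx ord0 j) pf.
apply: (eq_measurable_fun (fun x => 'D_(delta_mx ord0 j) f x)) => //.
  by move=> x; rewrite inE => -[Ux Kx]; rewrite (mesh_grad_poly oU pf vf)// mxE.
exact: poly_le_measurable pdf.
Qed.

Lemma bounded_mesh_grad U v : open U -> bounded_set U -> piecewise_poly U v ->
  exists B : R, forall x j, U x -> `|mesh_grad T v x ord0 j| <= B.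
Proof.
move=> oU [r [_ /(_ (r + 1))]]; rewrite ltrDl ltr01 => /(_ isT) Ur pv.
have : forall Kj : I * 'I_d, exists B : R, 0 <= B /\ forall x, U x ->
    (simplex (T Kj.1))° x -> `|mesh_grad T v x ord0 Kj.2| <= B.
  move=> [K j] /=; have [k [f [pf vf]]] := pv K.
  have [_ pdf] := poly_le_derivable (delta_mx ord0 j) pf.
  have [B fB] := poly_le_bounded (r + 1) pdf.
  exists `|B|; split=> // x Ux Kx; rewrite (mesh_grad_poly oU pf vf)// mxE.
  rewrite (le_trans _ (ler_norm B))// fB// => i.
  exact: le_trans (rV_coord_le_norm x i) (Ur x Ux).
move=> /choice[B /all_and2[B0 BP]]; exists (\sum_i B i) => x j Ux.
have [[K _ Kx]|Sx] := pselect ((\bigcup_K (simplex (T K))°) x); last first.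
  by rewrite mesh_grad_out// mxE normr0 sumr_ge0.
by rewrite (bigD1 (K, j))//= ler_wpDr ?sumr_ge0//; exact: (BP (K, j)).
Qed.

End mesh_gradient.

(** * The energy as a positive semidefinite form *)

Section energy_form.
Context {R : realType} {d : nat} {I : finType}.
Local Notation point := 'rV[R]_d.
Local Notation fct := ('rV[R]_d -> R).
Variables (Omega : set point) (T : I -> 'I_d.+1 -> point).
Variables (A : point -> 'M[R]_d) (alpha beta : R).
Hypotheses (oOmega : open Omega) (bOmega : bounded_set Omega).
Hypothesis hA : elliptic_coefficient Omega A alpha beta.

(** The integrand of [energy] as a form in two vectors, so that the inequalities for psd forms apply
    at each point. *)
Definition coef_form (x : point) (y z : point) : R := dotv (y *m (A x)^T) z.

Lemma coef_form_psd x : Omega x -> psd_form setT (coef_form x).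
Proof.
move=> Ox; split=> [c y y' z _ _ _|y z _ _|y _].
- rewrite /coef_form /dotv mulmxDl -scalemxAl mulr_sumr -big_split/=.
  by apply: eq_bigr => j _; rewrite !mxE mulrDl mulrA.
- have dotE (u v : point) : dotv u v = (u *m v^T) ord0 ord0.
    by rewrite mxE; apply: eq_bigr => j _; rewrite mxE.
  rewrite /coef_form !dotE (coef_sym hA Ox) -[in RHS](coef_sym hA Ox).
  by rewrite -[in RHS]mulmxA -trmx_mul -[in RHS](trmxK z) -trmx_mul [RHS]mxE.
- have /andP[+ _] := coef_elliptic hA y Ox; apply: le_trans.
  by rewrite mulr_ge0// ?sqr_ge0//; have /andP[/ltW] := coef_consts hA.
Qed.

Lemma subset_bounded_set (U : set point) : U `<=` Omega -> bounded_set U.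
Proof.
move=> UO; have [r [rr h]] := bOmega.
by exists r; split=> // s rs x /UO; exact: h.
Qed.

Section domain.
Variable U : set point.
Hypotheses (oU : open U) (UO : U `<=` Omega).

Lemma energy_integrable u v : piecewise_poly T U u -> piecewise_poly T U v ->
  (lebesgue_rV d).-integrable U
    (EFin \o (fun x => coef_form x (mesh_grad T u x) (mesh_grad T v x))).
Proof.
move=> pu pv; have bU := subset_bounded_set UO.
have mU := open_measurable_rV oU.
apply: measurable_bounded_integrable => //.
- exact: bounded_lebesgue_rV_lty.
- apply: measurable_sum => j; apply: measurable_realfun.measurable_funM; last first.
    exact: measurable_mesh_grad.
  apply: (eq_measurable_fun (fun x => \sum_l mesh_grad T u x ord0 l * A x j l)).
    by move=> x _; rewrite mxE; apply: eq_bigr => l _; rewrite mxE.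
  apply: measurable_sum => l; apply: measurable_realfun.measurable_funM.
    exact: measurable_mesh_grad.
  apply: measurable_funS UO _; first exact: open_measurable_rV.
  exact: (coef_measurable hA).
have [B uB] := bounded_mesh_grad oU bU pu.
have [C vC] := bounded_mesh_grad oU bU pv.
have dotB (z : point) D : (forall j, `|z ord0 j| <= D) -> dotv z z <= \sum_(j < d) D ^+ 2.
  move=> zD; apply: ler_sum => j _; rewrite -expr2 -real_normK ?num_real//.
  by rewrite lerXn2r ?nnegrE// (le_trans _ (zD j)).
have b0 : 0 <= beta by have /andP[a0 /ltW] := coef_consts hA; exact/le_trans/ltW.
(* Half the sum of the upper ellipticity bounds for the two gradients, by [psd_form_norm_le] at each
   point. *)
exists ((beta * \sum_(j < d) B ^+ 2 + beta * \sum_(j < d) C ^+ 2) / 2); split.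
  exact: num_real.
move=> r /ltW rC x Ux; apply: le_trans rC.
have Ox := UO Ux; have sT : linear_subspace (setT : set point) by split.
apply: le_trans (psd_form_norm_le sT (coef_form_psd Ox) Logic.I Logic.I) _.
rewrite ler_wpM2r// lerD//.
  have /andP[_] := coef_elliptic hA (mesh_grad T u x) Ox; move/le_trans; apply.
  rewrite ler_wpM2l// sqr_sqrtr ?dotB// => [j|]; first exact: uB.
  by apply: sumr_ge0 => j _; rewrite -expr2 sqr_ge0.
have /andP[_] := coef_elliptic hA (mesh_grad T v x) Ox; move/le_trans; apply.
rewrite ler_wpM2l// sqr_sqrtr ?dotB// => [j|]; first exact: vC.
by apply: sumr_ge0 => j _; rewrite -expr2 sqr_ge0.
Qed.

Lemma energy_psd : psd_form (piecewise_poly T U) (energy T A U).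
Proof.
have mU := open_measurable_rV oU; split=> [c u v z pu pv pz|u v pu pv|u pu].
- have iu := energy_integrable pu pz; have iv := energy_integrable pv pz.
  rewrite /energy -RintegralZl// -RintegralD//; last first.
    exact: (integrableZl mU c iu).
  apply: eq_Rintegral => x; rewrite inE => Ux.
  rewrite (mesh_grad_linear _ oU)//; exact: (psd_linear (coef_form_psd (UO Ux))).
- apply: eq_Rintegral => x; rewrite inE => Ux.
  exact: (psd_sym (coef_form_psd (UO Ux))).
- apply: Rintegral_ge0 => x Ux; exact: (psd_ge0 (coef_form_psd (UO Ux))).
Qed.

Lemma energy_eq u u' v v' : (forall x, U x -> u x = u' x) ->
  (forall x, U x -> v x = v' x) -> energy T A U u v = energy T A U u' v'.
Proof.
move=> uu' vv'; apply: eq_Rintegral => x; rewrite inE => Ux.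
by rewrite (mesh_grad_eq T oU Ux uu') (mesh_grad_eq T oU Ux vv').
Qed.

Lemma energy_local u v :
  (forall x, Omega x -> ~ U x -> mesh_grad T v x = 0) ->
  energy T A U u v = energy T A Omega u v.
Proof.
move=> v0; rewrite /energy Rintegral_mkcond [RHS]Rintegral_mkcond.
apply: eq_Rintegral => x _; rewrite /patch/=; case: ifPn => xU; case: ifPn => xO//.
- by move: xO; rewrite mem_set//; apply: UO; exact: set_mem.
- rewrite v0//; first by rewrite /dotv big1// => j _; rewrite !mxE mulr0.
    exact: set_mem.
  by move: xU; rewrite notin_setE.
Qed.

End domain.
End energy_form.

(** * Finite element functions and overlaps *)

Lemma integrable_sum_EFin dsp (X : measurableType dsp) (R : realType)
    (mu : {measure set X -> \bar R}) (D : set X) (J : Type) (s : seq J)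
    (f : J -> X -> R) :
  measurable D -> (forall i, mu.-integrable D (EFin \o f i)) ->
  mu.-integrable D (EFin \o (fun x => \sum_(i <- s) f i x)).
Proof.
move=> mD fi; rewrite (_ : _ \o _ = (fun x => \sum_(i <- s) (f i x)%:E)%E).
  by apply: integrable_sum => // i _; exact: fi.
by apply/funext => x; rewrite /= sumEFin.
Qed.

Lemma Rintegral_sum dsp (X : measurableType dsp) (R : realType)
    (mu : {measure set X -> \bar R}) (D : set X) (J : Type) (s : seq J)
    (f : J -> X -> R) :
  measurable D -> (forall i, mu.-integrable D (EFin \o f i)) ->
  \int[mu]_(x in D) (\sum_(i <- s) f i x) = \sum_(i <- s) \int[mu]_(x in D) f i x.
Proof.
move=> mD fi; elim: s => [|i s ih].
  rewrite big_nil /Rintegral; under eq_integral do rewrite big_nil.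
  by rewrite integral0.
rewrite big_cons -ih -RintegralD//; last exact: integrable_sum_EFin.
by apply: eq_Rintegral => x _; rewrite big_cons.
Qed.

Lemma linear_fun_sum (R : pzRingType) (U V : lmodType R) (L : U -> V)
    (J : finType) (P : pred J) (c : J -> R) (f : J -> U) :
  (forall a u v, L (a *: u + v) = a *: L u + L v) ->
  L (\sum_(i | P i) c i *: f i) = \sum_(i | P i) c i *: L (f i).
Proof.
move=> Ll; have L0 : L 0 = 0.
  by have := Ll (-1) 0 0; rewrite scaler0 addr0 scaleN1r addNr.
by elim/big_rec2: _ => // i u v _ <-; rewrite Ll.
Qed.

Section fem_space.
Context {R : realType} {d : nat} {I : finType}.
Local Notation point := 'rV[R]_d.
Local Notation fct := ('rV[R]_d -> R).
Variables (Omega : set point) (T : I -> 'I_d.+1 -> point) (k : nat).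

Lemma polynomial_on_linear (S : set point) c (u v : fct) :
  polynomial_on k S u -> polynomial_on k S v -> polynomial_on k S (c *: u + v).
Proof.
move=> [a uE] [b vE]; exists (fun i => c * a i + b i) => x Sx.
rewrite -[LHS]/(c * u x + v x) uE// vE// mulr_sumr -big_split/=.
by apply: eq_bigr => i _; rewrite mulrDl mulrA.
Qed.

Lemma Vh_subspace : linear_subspace (Vh Omega T k).
Proof.
split=> [|c u v [cu u0 pu] [cv v0 pv]].
  split=> //; first by move=> x; exact: cst_continuous.
  by move=> K; exists (fun=> 0) => x _; rewrite big1// => a _; rewrite mul0r.
split=> [x|x Ox|K]; last exact: polynomial_on_linear.
- apply: continuousD; last exact: cv.
  by apply: continuousZr; exact: cu.
- by rewrite -[LHS]/(c * u x + v x) u0// v0// mulr0 addr0.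
Qed.

Lemma restr_linear (w : set point) (c : R) (u v : fct) :
  restr w (c *: u + v) = c *: restr w u + restr w v.
Proof.
apply/funext => x; rewrite -[RHS]/(c * restr w u x + restr w v x) /restr /patch.
by case: ifP => // _; rewrite mulr0 addr0.
Qed.

Lemma restr_id (w : set point) (u : fct) x : w x -> restr w u x = u x.
Proof. by move=> wx; rewrite /restr patchT// inE. Qed.

Lemma restr_out (w : set point) (u : fct) x : ~ w x -> restr w u x = 0.
Proof. by move=> wx; rewrite /restr patchN// notin_setE. Qed.

Lemma restr_restr (w w' : set point) (u : fct) : w `<=` w' ->
  restr w (restr w' u) = restr w u.
Proof.
move=> ww'; apply/funext => x; have [wx|wx] := pselect (w x).
  by rewrite !restr_id//; exact: ww'.
by rewrite !restr_out.
Qed.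

Hypotheses (k0 : (0 < k)%N) (hT : triangulation Omega T).

(** Unisolvence on every element; identities for [Ih] thereby reduce to checks at the nodes in
    [Omega]. *)
Lemma Vh_nodal_eq u v : Vh Omega T k u -> Vh Omega T k v ->
  (forall x, lagrange_node T k x -> Omega x -> u x = v x) -> u = v.
Proof.
move=> Vu Vv uv; apply/funext => x; have [Ox|nOx] := pselect (Omega x); last first.
  by case: Vu Vv => _ u0 _ [_ v0 _]; rewrite u0// v0.
have [K _ Kx] : (\bigcup_K simplex (T K)) x.
  by rewrite -(mesh_cover hT); exact: subset_closure.
apply/eqP; rewrite -subr_eq0; apply/eqP; rewrite -[LHS]/((u - v) x).
apply: (Vh_unisolvent k0 (subspaceB Vh_subspace Vu Vv) _ Kx) => y ny Oy _.
by rewrite -[LHS]/(u y - v y) uv// subrr.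
Qed.

(** If [v] were nonzero somewhere in the interior of the element around [x], that open set would
    meet the closure of [U], hence [U] itself, and would lie in [U] together with [x]. *)
Lemma Vh0_mesh_grad_out (U : set point) v x : resolved T U ->
  Vh0 Omega T k U v -> ~ U x -> mesh_grad T v x = 0.
Proof.
move=> rU [_ sv] nUx.
have [[K _ Kx]|Sx] := pselect ((\bigcup_K (simplex (T K))°) x); last first.
  by rewrite mesh_grad_out.
have oK : open (simplex (T K))° by exact: open_interior.
have v0 y : (simplex (T K))° y -> v y = 0.
  move=> Ky; apply/eqP/negPn/negP => vy.
  have /sv/(_ (simplex (T K))°)[] : closure [set x | v x != 0] y.
    exact: subset_closure.
  - exact: open_nbhs_nbhs.
  - by move=> z [Uz Kz]; exact/nUx/(resolved_interior hT rU Kz Uz).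
rewrite (@mesh_grad_eq _ _ _ T _ v (fun=> 0) x oK)//.
exact: (mesh_grad0 (K := K)).
Qed.

Section interpolation.
Variable Ih : fct -> fct.
Hypothesis hIh : lagrange_interpolation Omega T k Ih.

Lemma interpolation_Vh f : Vh Omega T k (Ih f).
Proof. by case: (hIh f). Qed.

Lemma interpolation_node f x : lagrange_node T k x -> Omega x -> Ih f x = f x.
Proof. by case: (hIh f) => _; exact. Qed.

Lemma interpolation_linear c f g : Ih (c *: f + g) = c *: Ih f + Ih g.
Proof.
apply: Vh_nodal_eq; first exact: interpolation_Vh.
  by apply: Vh_subspace.2; exact: interpolation_Vh.
move=> x nx Ox; rewrite -[RHS]/(c * Ih f x + Ih g x).
by rewrite !interpolation_node.
Qed.

Variables (M : nat) (w : 'I_M -> set point) (chi : 'I_M -> fct).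

(** Convertible both to [chi_h_tilde] and to the expression in the eigenproblems, which lets one
    linear map serve for both. *)
Definition local_chi i v := chi_h Ih chi i (restr (w i) v).

Lemma local_chi_Vh i v : Vh Omega T k (local_chi i v).
Proof. exact: interpolation_Vh. Qed.

Lemma local_chi_linear i c u v :
  local_chi i (c *: u + v) = c *: local_chi i u + local_chi i v.
Proof.
rewrite /local_chi /chi_h restr_linear -interpolation_linear; congr Ih.
apply/funext => x; rewrite -[LHS]/(chi i x * (c * _ + _)) mulrDr mulrCA.
by [].
Qed.

Lemma local_chi_sum Cchi v : partition_of_unity Omega w chi Cchi ->
  Vh Omega T k v -> \sum_i local_chi i v = v.
Proof.
move=> hchi Vv; apply: Vh_nodal_eq => //.
  by apply: (subspace_sum Vh_subspace) => i _; exact: local_chi_Vh.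
move=> x nx Ox; rewrite fct_sumE -[RHS]mul1r -(pou_sum hchi Ox) mulr_suml.
apply: eq_bigr => i _; rewrite /local_chi /chi_h interpolation_node//.
have [wx|wx] := pselect (w i x); first by rewrite /= restr_id.
by rewrite /= restr_out// (pou_vanish hchi Ox wx) !mul0r.
Qed.

(** Interpolation does not spread beyond [w i]: a node of the element around [x] lying in the open
    set [w i] would force the whole element interior, and so [x], into [w i]. All nodal values on
    the element therefore vanish. *)
Lemma local_chi_mesh_grad_out i v x : resolved T (w i) -> ~ w i x ->
  mesh_grad T (local_chi i v) x = 0.
Proof.
move=> rw nwx.
have [[K _ Kx]|Sx] := pselect ((\bigcup_K (simplex (T K))°) x); last first.
  by rewrite mesh_grad_out.
apply: (mesh_grad0 _ (Kx)); apply: (Vh_unisolvent k0); first exact: local_chi_Vh.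
move=> y ny Oy Ky; rewrite /local_chi /chi_h interpolation_node//=.
rewrite restr_out ?mulr0// => wy; apply: nwx.
have nK := mesh_nondegenerate hT K.
have [z wz z0] := open_meets_simplex nK (resolved_open rw) wy Ky.
exact: (resolved_interior hT rw (bary_gt0_interior nK z0) wz).
Qed.

End interpolation.
End fem_space.

(** * The two overlap factors *)

Section overlap.
Context {R : realType} {d M : nat} {I : finType}.
Local Notation point := 'rV[R]_d.
Local Notation fct := ('rV[R]_d -> R).
Variables (Omega : set point) (T : I -> 'I_d.+1 -> point).
Variables (A : point -> 'M[R]_d) (alpha beta : R).
Hypotheses (oOmega : open Omega) (bOmega : bounded_set Omega).
Hypothesis hA : elliptic_coefficient Omega A alpha beta.
Variable w : 'I_M -> set point.
Hypotheses (ow : forall i, open (w i)) (wO : forall i, w i `<=` Omega).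

Lemma card_le_overlap x : Omega x -> (#|[set i | x \in w i]%SET| <= overlap Omega w)%N.
Proof.
by move=> Ox; apply: leq_bigmax_cond; apply/asboolP; exists x.
Qed.

Lemma overlap_gt0 x i : Omega x -> w i x -> (0 < overlap Omega w)%N.
Proof.
move=> Ox wx; apply: leq_trans (card_le_overlap Ox); apply/card_gt0P; exists i.
by rewrite inE mem_set.
Qed.

(** At each point only the gradients with [x] in [w i] survive, so [psd_form_sum_le] costs at most
    the overlap; integrating gives the claim. *)
Lemma energy_sum_le (z : 'I_M -> fct) :
  (forall i, piecewise_poly T Omega (z i)) ->
  (forall i x, Omega x -> ~ w i x -> mesh_grad T (z i) x = 0) ->
  energy T A Omega (\sum_i z i) (\sum_i z i) <=
  (overlap Omega w)%:R * \sum_i energy T A (w i) (z i) (z i).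
Proof.
move=> pz z0.
rewrite [X in _ * X](eq_bigr (fun i => energy T A Omega (z i) (z i))); last first.
  by move=> i _; apply: (energy_local A (@wO i)); exact: z0.
have mO := open_measurable_rV oOmega.
have ii i := energy_integrable oOmega bOmega hA oOmega (@subset_refl _ _) (pz i) (pz i).
rewrite /energy -Rintegral_sum//.
have isum : (lebesgue_rV d).-integrable Omega (EFin \o (fun x =>
    \sum_i coef_form A x (mesh_grad T (z i) x) (mesh_grad T (z i) x))).
  exact: integrable_sum_EFin.
rewrite -RintegralZl//; apply: le_Rintegral => //.
- apply: (energy_integrable oOmega bOmega hA oOmega (@subset_refl _ _)).
    by apply: (subspace_sum (piecewise_poly_subspace _ _)).
  by apply: (subspace_sum (piecewise_poly_subspace _ _)).
- exact: (integrableZl mO _ isum).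
move=> x Ox; have pB := coef_form_psd hA Ox.
have sT : linear_subspace (setT : set point) by split.
rewrite (mesh_grad_sum _ oOmega)//.
have E : \sum_i mesh_grad T (z i) x = \sum_(i in [set i | x \in w i]%SET) mesh_grad T (z i) x.
  rewrite [RHS]big_mkcond/=; apply: eq_bigr => i _; rewrite inE.
  by case: ifPn => //; rewrite notin_setE => /(z0 i _ Ox).
rewrite E -/(coef_form A x _ _).
apply: (le_trans (psd_form_sum_le sT pB _ (fun=> Logic.I))).
apply: ler_pM => //; first by apply: sumr_ge0 => i _; exact: (psd_ge0 pB).
  by rewrite ler_nat card_le_overlap.
rewrite [leRHS](bigID (fun i => i \in [set i | x \in w i]%SET))/= lerDl.
by apply: sumr_ge0 => i _; exact: (psd_ge0 pB).
Qed.

(** Each local energy is the integral over [Omega] of one nonnegative density cut off to [w i]; at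
    any point at most [overlap Omega w] copies remain. *)
Lemma sum_energy_le (u : fct) : piecewise_poly T Omega u ->
  \sum_i energy T A (w i) u u <= (overlap Omega w)%:R * energy T A Omega u u.
Proof.
move=> pu; have mO := open_measurable_rV oOmega.
pose f x := coef_form A x (mesh_grad T u x) (mesh_grad T u x).
have fi : (lebesgue_rV d).-integrable Omega (EFin \o f).
  exact: (energy_integrable oOmega bOmega hA oOmega (@subset_refl _ _)).
have fwi i : (lebesgue_rV d).-integrable Omega (EFin \o (f \_ (w i))).
  have mw := open_measurable_rV (@ow i).
  apply: (@integrableS _ _ _ _ setT) => //.
  rewrite -restrict_EFin; apply: (integrable_mkcond _ mw).1.
  exact: (integrableS mO mw (@wO i) fi).
have E i : energy T A (w i) u u = \int[lebesgue_rV d]_(x in Omega) (f \_ (w i)) x.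
  by rewrite -Rintegral_mkcondr (_ : Omega `&` w i = w i)//; exact/setIidr/wO.
under eq_bigr do rewrite E.
rewrite -Rintegral_sum// /energy -/f -RintegralZl//; apply: le_Rintegral => //.
- exact: integrable_sum_EFin.
- exact: (integrableZl mO _ fi).
move=> x Ox; have f0 : 0 <= f x := psd_ge0 (coef_form_psd hA Ox) Logic.I.
rewrite (eq_bigr (fun i => if i \in [set i | x \in w i]%SET then f x else 0)); last first.
  by move=> i _; rewrite /patch inE.
rewrite -big_mkcond sumr_const -[leLHS]mulr_natl ler_wpM2r// ler_nat.
exact: card_le_overlap.
Qed.

End overlap.

(** * Contraction of the iteration *)

Section local_error.
Context {R : realType} {d M : nat} {I : finType}.
Local Notation point := 'rV[R]_d.
Local Notation fct := ('rV[R]_d -> R).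
Variables (Omega : set point) (T : I -> 'I_d.+1 -> point) (k : nat).
Variables (A : point -> 'M[R]_d) (alpha beta : R).
Hypotheses (oOmega : open Omega) (bOmega : bounded_set Omega).
Hypothesis hA : elliptic_coefficient Omega A alpha beta.
Hypotheses (k0 : (0 < k)%N) (hT : triangulation Omega T).
Variable Ih : fct -> fct.
Hypothesis hIh : lagrange_interpolation Omega T k Ih.
Variables (w ws : 'I_M -> set point) (chi : 'I_M -> fct).
Hypotheses (rw : forall i, resolved T (w i)) (rws : forall i, resolved T (ws i)).
Hypotheses (wws : forall i, w i `<=` ws i) (wsO : forall i, ws i `<=` Omega).

Let owi i : open (w i) := resolved_open (rw i).
Let owsi i : open (ws i) := resolved_open (rws i).
Let wO i : w i `<=` Omega := subset_trans (@wws i) (@wsO i).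

Lemma local_chi_energy_psd (X : set fct) i :
  psd_form X (fun u v => energy T A (w i) (local_chi Ih w chi i u)
                                          (local_chi Ih w chi i v)).
Proof.
have pE := energy_psd T oOmega bOmega hA (@owi i) (@wO i).
have pl u : piecewise_poly T (w i) (local_chi Ih w chi i u).
  exact: Vh_piecewise_poly (local_chi_Vh hIh w chi i u).
split=> [c u v z _ _ _|u v _ _|u _].
- by rewrite (local_chi_linear k0 hT hIh) (psd_linear pE).
- exact: (psd_sym pE).
- exact: (psd_ge0 pE).
Qed.

Lemma VhA_piecewise_poly i : VhA Omega T k A (ws i) `<=` piecewise_poly T (ws i).
Proof.
move=> _ [[u Vu <-] _].
apply: piecewise_poly_eq (Vh_piecewise_poly (ws i) Vu) => x wx.
by rewrite restr_id.
Qed.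

(** Test functions of [Vh0] have zero gradient off [ws i], so orthogonality over [Omega] is
    orthogonality over [ws i]. As [p] is itself such a function, Pythagoras bounds the energy of
    [e - p]. *)
Lemma VhA_restr_sub i (e p : fct) : Vh Omega T k e -> Vh0 Omega T k (ws i) p ->
  (forall z, Vh0 Omega T k (ws i) z -> energy T A Omega (e - p) z = 0) ->
  VhA Omega T k A (ws i) (restr (ws i) (e - p)) /\
  energy T A (ws i) (restr (ws i) (e - p)) (restr (ws i) (e - p))
    <= energy T A (ws i) e e.
Proof.
move=> Ve Vp ortho.
have Vep := subspaceB (Vh_subspace Omega T k) Ve Vp.1.
have loc z : Vh0 Omega T k (ws i) z -> energy T A (ws i) (e - p) z = 0.
  move=> Vz; rewrite (energy_local A (@wsO i)) ?ortho// => x _ nwx.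
  exact: Vh0_mesh_grad_out hT _ _ _ (rws i) Vz nwx.
have restrE := energy_eq T A (@owsi i).
split.
  split; first by exists (e - p).
  move=> z Vz; rewrite -(loc z Vz); apply: restrE => // x wx.
  exact: restr_id.
rewrite (restrE _ (e - p) _ (e - p)); try by move=> x wx; exact: restr_id.
have pE := energy_psd T oOmega bOmega hA (@owsi i) (@wsO i).
have sX := piecewise_poly_subspace T (ws i).
have pp := Vh_piecewise_poly (ws i) Vp.1.
have pep := Vh_piecewise_poly (ws i) Vep.
rewrite -[in leRHS](subrK p e) (psd_form_pythagoras sX pE pep pp (loc p Vp)).
by rewrite lerDl (psd_ge0 pE).
Qed.

(** In the eigenbasis expansion of [e - p] on [ws i], [s] is the restricted head of [m] terms and
    [z] the tail. *)
Lemma local_error_le i n (lam : nat -> \bar R) (phi : nat -> fct) m (r : R)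
    (e p : fct) :
  eigenbasis (VhA Omega T k A (ws i))
    (fun u v => energy T A (w i) (local_chi Ih w chi i u) (local_chi Ih w chi i v))
    (energy T A (ws i)) n lam phi ->
  (m <= n)%N -> (next_eigenvalue n m lam <= r%:E)%E ->
  Vh Omega T k e -> Vh0 Omega T k (ws i) p ->
  (forall z, Vh0 Omega T k (ws i) z -> energy T A Omega (e - p) z = 0) ->
  exists s z : fct,
    [/\ [set \sum_(l < m) c l *: restr (w i) (phi l) | c in [set: 'I_m -> R]] s,
        local_chi Ih w chi i z = local_chi Ih w chi i e - local_chi Ih w chi i p -
          chi_h Ih chi i s &
        energy T A (w i) (local_chi Ih w chi i z) (local_chi Ih w chi i z)
          <= r * energy T A (ws i) e e].
Proof.
move=> eig mn mr Ve Vp ortho; have [VAe Ele] := VhA_restr_sub Ve Vp ortho.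
have : VhA Omega T k A (ws i) (restr (ws i) (e - p)) by [].
rewrite (eig_span eig) => -[c _ cE].
have sX := piecewise_poly_subspace T (ws i).
have VAX := @VhA_piecewise_poly i.
have pE := energy_psd T oOmega bOmega hA (@owsi i) (@wsO i).
have tail := eigenbasis_tail_le sX VAX pE (local_chi_energy_psd _ i) eig c mr.
have r0 : 0 <= r.
  rewrite -lee_fin (le_trans _ mr)//.
  exact: (next_eigenvalue_ge0 sX VAX pE (local_chi_energy_psd _ i) eig).
exists (\sum_(l < m) (c \o widen_ord mn) l *: restr (w i) (phi l)).
exists (\sum_(l < n | (m <= l)%N) c l *: phi l); split; last first.
- by apply: (le_trans tail); rewrite cE ler_wpM2l.
- have lin := local_chi_linear k0 hT hIh w chi i.
  have linB u v : local_chi Ih w chi i (u - v) =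
      local_chi Ih w chi i u - local_chi Ih w chi i v.
    by rewrite addrC -scaleN1r lin scaleN1r addrC.
  have -> : chi_h Ih chi i (\sum_(l < m) (c \o widen_ord mn) l *: restr (w i) (phi l)) =
      local_chi Ih w chi i (\sum_(l < n | (l < m)%N) c l *: phi l).
    rewrite /local_chi (linear_fun_sum _ _ _ (restr_linear (w i))).
    by rewrite (big_ord_narrow mn).
  (* [local_chi] sees its argument only on [w i], so the cut-off to the larger [ws i] changes
     nothing. *)
  have <- : local_chi Ih w chi i (restr (ws i) (e - p)) =
      local_chi Ih w chi i e - local_chi Ih w chi i p.
    by rewrite -linB /local_chi restr_restr.
  rewrite -linB -cE [in RHS](bigID (fun l : 'I_n => (l < m)%N))/= addrAC subrr add0r.
  by congr local_chi; apply: eq_bigl => l; rewrite -leqNgt.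
- by exists (c \o widen_ord mn).
Qed.

End local_error.

(** Best approximation: [q - P q] is orthogonal to [P q] and to [s], so Pythagoras applies to
    [(q - P q) + (P q - s)]. *)
Lemma energy_projection_le (R : realType) (d : nat) (I : finType)
    (Omega : set 'rV[R]_d) (T : I -> 'I_d.+1 -> 'rV[R]_d) (k : nat)
    (A : 'rV[R]_d -> 'M[R]_d) (W : set ('rV[R]_d -> R)) P q s :
  psd_form (Vh Omega T k) (energy T A Omega) -> W `<=` Vh Omega T k ->
  energy_projection Omega T k A W P -> Vh Omega T k q -> W s ->
  energy T A Omega (q - P q) (q - P q) <= energy T A Omega (q - s) (q - s).
Proof.
move=> pE WV hP Vq Ws; have [WPq ortho] := hP q Vq.
have sV := Vh_subspace Omega T k.
have [VPq Vs] := (WV _ WPq, WV _ Ws).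
have Vf := subspaceB sV Vq VPq; have Vg := subspaceB sV VPq Vs.
have -> : q - s = (q - P q) + (P q - s) by rewrite addrA subrK.
rewrite (psd_form_pythagoras sV pE Vf Vg); first by rewrite lerDl (psd_ge0 pE).
by rewrite (psd_formBr sV pE)// !ortho// subrr.
Qed.

Theorem proposition3p4 (R : realType) (d : nat) (hd : d = 2%N \/ d = 3%N)
  (* domain, coefficient, right-hand side *)
  (Omega : set 'rV[R]_d) (hOmega : polygonal_lipschitz_domain Omega)
  (A : 'rV[R]_d -> 'M[R]_d) (alpha beta : R)
  (hA : elliptic_coefficient Omega A alpha beta)
  (ell : ('rV[R]_d -> R) -> R) (hell : linear_functional_H10 Omega ell)
  (* mesh, finite element space of degree k, nodal interpolation *)
  (I : finType) (T : I -> 'I_d.+1 -> 'rV[R]_d) (hT : triangulation Omega T)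
  (h : R) (hh : h = mesh_size T) (sigma : R) (hsigma : shape_regular T sigma)
  (k : nat) (hk : (0 < k)%N)
  (Ih : ('rV[R]_d -> R) -> 'rV[R]_d -> R)
  (hIh : lagrange_interpolation Omega T k Ih)
  (* decomposition, oversampling domains, partition of unity *)
  (M : nat) (w ws : 'I_M -> set 'rV[R]_d)
  (hw0 : forall i, w i !=set0)
  (hw : forall i, resolved T (w i)) (hws : forall i, resolved T (ws i))
  (hcover : Omega = \bigcup_i w i)
  (hww : forall i, w i `<=` ws i) (hwsO : forall i, ws i `<=` Omega)
  (chi : 'I_M -> 'rV[R]_d -> R) (Cchi : R)
  (hchi : partition_of_unity Omega w chi Cchi)
  (* local eigenproblems and coarse space *)
  (n : 'I_M -> nat) (lam : 'I_M -> nat -> \bar R)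
  (phi : 'I_M -> nat -> 'rV[R]_d -> R)
  (heig : forall i,
     eigenbasis (VhA Omega T k A (ws i))
       (fun u v => energy T A (w i) (chi_h Ih chi i (restr (w i) u))
                                    (chi_h Ih chi i (restr (w i) v)))
       (energy T A (ws i)) (n i) (lam i) (phi i))
  (m : 'I_M -> nat) (hm : forall i, (m i <= n i)%N)
  (* a-orthogonal projections *)
  (P : 'I_M -> ('rV[R]_d -> R) -> 'rV[R]_d -> R)
  (hP : forall i, energy_projection Omega T k A (Vh0 Omega T k (ws i)) (P i))
  (PS : ('rV[R]_d -> R) -> 'rV[R]_d -> R)
  (hPS : energy_projection Omega T k A (coarse_space Ih chi w m phi) PS)
  (* discrete solution and iteration *)
  (uh : 'rV[R]_d -> R) (huh : Vh Omega T k uh)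
  (hsol : forall v, Vh Omega T k v -> energy T A Omega uh v = ell v)
  (v : nat -> 'rV[R]_d -> R) (hv0 : Vh Omega T k (v 0%N))
  (hv : forall j, v j.+1 = v j + msgfem_map Ih chi w P PS (uh - v j)) :
  let Lambda : \bar R :=
    sqrte (((overlap Omega w)%:R * (overlap Omega ws)%:R)%:E *
           \big[maxe/-oo]_i next_eigenvalue (n i) (m i) (lam i))%E in
  (Lambda < +oo)%E ->
  forall j, ((energy_norm T A Omega (v j.+1 - uh))%:E <=
             Lambda * (energy_norm T A Omega (v j - uh))%:E)%E.
Proof.
move=> Lambda Loo j.
have oO := domain_open hOmega; have bO := domain_bounded hOmega.
have ow i : open (w i) := resolved_open (hw i).
have ows i : open (ws i) := resolved_open (hws i).
have wO i : w i `<=` Omega := subset_trans (@hww i) (@hwsO i).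
have sV := Vh_subspace Omega T k.
have VX u : Vh Omega T k u -> piecewise_poly T Omega u by exact: Vh_piecewise_poly.
have pEO := energy_psd T oO bO hA oO (@subset_refl _ Omega).
have pE : psd_form (Vh Omega T k) (energy T A Omega).
  split=> [c u u' z Vu Vu' Vz|u u' Vu Vu'|u Vu].
  - by rewrite (psd_linear pEO)//; exact: VX.
  - by rewrite (psd_sym pEO)//; exact: VX.
  - by rewrite (psd_ge0 pEO)//; exact: VX.
have CV : coarse_space Ih chi w m phi `<=` Vh Omega T k.
  move=> _ [s _ <-]; apply: (subspace_sum sV) => i _; exact: (interpolation_Vh hIh).
have Vloc i u : Vh Omega T k (local_chi Ih w chi i u) := local_chi_Vh hIh w chi i u.
have Vp u : Vh Omega T k (\sum_i chi_h_tilde Ih chi w i (P i u)).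
  by apply: (subspace_sum sV) => i _; exact: Vloc.
have VG u : Vh Omega T k u -> Vh Omega T k (msgfem_map Ih chi w P PS u).
  move=> Vu; apply: (subspaceD sV) => //.
  by apply: CV; have [] := hPS _ (subspaceB sV Vu (Vp u)).
have Vv : Vh Omega T k (v j).
  elim: j => // j Vvj; rewrite hv; apply: (subspaceD sV) => //.
  by apply: VG; exact: subspaceB.
(* A point of [Omega] supplies an index [i0], which makes both overlaps positive and the family of
   eigenvalues nonempty. *)
have [x0 Ox0] := domain_nonempty hOmega.
have [i0 wx0] : exists i, w i x0 by move: Ox0; rewrite hcover => -[i _]; exists i.
pose N : R := (overlap Omega w)%:R * (overlap Omega ws)%:R.
have N0 : 0 < N.
  by rewrite mulr_gt0// ltr0n (overlap_gt0 Ox0 (i := i0))//; exact: hww.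
pose mx := \big[maxe/-oo%E]_i next_eigenvalue (n i) (m i) (lam i).
have next_ge0 i : (0 <= next_eigenvalue (n i) (m i) (lam i))%E.
  apply: (next_eigenvalue_ge0 (piecewise_poly_subspace T (ws i)) _ _ _ (heig i)).
  - exact: VhA_piecewise_poly.
  - exact: (energy_psd T oO bO hA (@ows i) (@hwsO i)).
  - exact: (local_chi_energy_psd oO bO hA hk hT hIh chi hw hww hwsO _ i).
have next_le i : (next_eigenvalue (n i) (m i) (lam i) <= mx)%E := le_bigmax _ _ i.
(* The maximum is not [-oo], being at least a nonnegative eigenvalue, and not [+oo], since [N > 0]
   would then make [Lambda] infinite. *)
have [r mxE] : exists r, mx = r%:E.
  have := le_trans (next_ge0 i0) (next_le i0).
  move: Loo; rewrite /Lambda -/N -/mx; case: (mx) => [r| |]//; first by exists r.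
  by rewrite gt0_muley ?lte_fin//= ltxx.
rewrite mxE in next_le.
have r0 : 0 <= r by rewrite -lee_fin (le_trans (next_ge0 i0)).
have -> : Lambda = (Num.sqrt (N * r))%:E by rewrite /Lambda -/mx mxE.
rewrite -EFinM lee_fin /energy_norm -sqrtrM; last by rewrite mulr_ge0// ltW.
apply: ler_wsqrtr.
pose e := uh - v j; have Ve : Vh Omega T k e by exact: subspaceB.
pose p := \sum_i chi_h_tilde Ih chi w i (P i e).
have energyN u : Vh Omega T k u -> energy T A Omega (- u) (- u) = energy T A Omega u u.
  move=> Vu; have VNu := subspaceZ sV (-1) Vu; rewrite -scaleN1r.
  rewrite (psd_formZl sV pE)// (psd_sym pE)// (psd_formZl sV pE)//.
  by rewrite !mulN1r opprK.
have -> : v j - uh = - e by rewrite opprB.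
have -> : v j.+1 - uh = - ((e - p) - PS (e - p)).
  rewrite hv -/e /msgfem_map -/p; set g := PS _.
  apply/funext => x; rewrite -[LHS]/(v j x + (p x + g x) - uh x).
  by rewrite -[RHS]/(- (uh x - v j x - p x - g x)); ring.
have Vq : Vh Omega T k (e - p) by exact: (subspaceB sV Ve (Vp e)).
have VPq : Vh Omega T k (PS (e - p)) by apply: CV; have [] := hPS _ Vq.
rewrite !energyN//; last exact: (subspaceB sV Vq VPq).
have loc i := local_error_le oO bO hA hk hT hIh hw hws hww hwsO (heig i) (hm i)
  (next_le i) Ve (hP i e Ve).1 (hP i e Ve).2.
have [s /choice[z /all_and3[Cs zE zle]]] := choice loc.
have Csum : coarse_space Ih chi w m phi (\sum_i chi_h Ih chi i (s i)) by exists s.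
apply: (le_trans (energy_projection_le pE CV hPS Vq Csum)).
(* Here [e] is the sum of its [local_chi] images, and [p] is by definition the sum of those of the
   local projections [P i e]. *)
have -> : e - p - \sum_i chi_h Ih chi i (s i) = \sum_i local_chi Ih w chi i (z i).
  rewrite (eq_bigr _ (fun i _ => zE i)) !sumrB.
  by rewrite (local_chi_sum hk hT hIh hchi Ve).
apply: le_trans
  (energy_sum_le oO bO hA wO (z := fun i => local_chi Ih w chi i (z i)) _ _) _.
- by move=> i; exact: VX.
- by move=> i x _; exact: (local_chi_mesh_grad_out hk hT hIh).
rewrite /N -!mulrA ler_wpM2l// mulrCA.
apply: (@le_trans _ _ (r * \sum_i energy T A (ws i) e e)).
  by rewrite mulr_sumr; apply: ler_sum => i _; exact: zle.
by rewrite ler_wpM2l// (sum_energy_le oO bO hA ows hwsO (VX _ Ve)).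
Qed.
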